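(* Let $n\ge1$, let $\pi:S^{2n+1}\to\mathbb{C}P^n$ be the Hopf bundle, let $\gamma=\gamma(t):\mathbb{R}\to\mathbb{C}P^n$ be a regular curve, and let $x=\pi^{-1}\gamma:\mathbb{R}\times S^1\to S^{2n+1}$ be the $S^1$-invariant surface in $S^{2n+1}$ derived from $\gamma$ via the Hopf bundle. If $x$ is of flat normal bundle, then by some conformal transformation of $S^{2n+1}$, $x$ can be located in some $S^3\subset S^{2n+1}$, and $\gamma$ lies in some $\mathbb{C}P^1\subset\mathbb{C}P^n$. If, furthermore, $x$ is Willmore, then $x$ is one of Pinkall's examples, i.e. $x$ is the inverse image, under the Hopf fibration $S^3\to\mathbb{C}P^1$, of an elastic curve $\gamma$ in $\mathbb{C}P^1\cong S^2$.
   Context: $S^{2n+1}=\{Z\in\mathbb{C}^{n+1}:\langle Z,Z\rangle=1\}$ is the unit sphere, $\pi$ is the quotient by the $S^1$-action $Z\mapsto e^{\sqrt{-1}\theta}Z$, and $\mathbb{C}P^n$ carries the metric making $\pi$ a Riemannian submersion (so a projective line $\mathbb{C}P^1$ is a round sphere of curvature $4$). A regular curve is a smooth curve with nowhere vanishing velocity. It admits a horizontal lift $\tilde\gamma:\mathbb{R}\to S^{2n+1}$, i.e. $\pi\circ\tilde\gamma=\gamma$ and $\tilde\gamma_t\perp\sqrt{-1}\tilde\gamma$, and the surface is $x(t,\theta)=e^{\sqrt{-1}\theta}\tilde\gamma(t)$, an immersion (conformal with respect to $z=t+i\theta$ when $t$ is arclength). Flat normal bundle: the curvature of the normal connection of $x$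 in $S^{2n+1}$ vanishes identically. Willmore: $x$ is critical, under compactly supported variations, for the Willmore functional, equal up to a constant factor to the integral of the squared norm of the trace-free second fundamental form. Elastic curve here: a curve in $\mathbb{C}P^1$ (round sphere of curvature $4$) that is critical under compactly supported variations for $\int(k^2+4)\,ds$, $k$ being the geodesic curvature and $s$ the arclength; equivalently $2k''+k^3+4k=0$. *)

(* Defs.v *)
From HB Require Import structures.
From mathcomp Require Import all_boot all_order all_algebra.
From mathcomp Require Import complex.
From mathcomp Require Import all_classical all_reals all_analysis.

Set Implicit Arguments.
Unset Strict Implicit.
Unset Printing Implicit Defensive.

Import Order.TTheory GRing.Theory Num.Theory.
Import numFieldNormedType.Exports.

Local Open Scope classical_set_scope.
Local Open Scope ring_scope.

Section Smooth.
Context {R : realType} {V W : normedModType R}.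

(* C^k on an open set U: all iterated directional derivatives of order at most
   k exist and are continuous on U.  For finite-dimensional V, the only case
   used here, this is the usual class C^k. *)
Fixpoint Ck_on (U : set V) (k : nat) (f : V -> W) : Prop :=
  (forall p, U p -> {for p, continuous f}) /\
  (if k is k'.+1 then
     forall v, (forall p, U p -> derivable f p v) /\ Ck_on U k' ('D_v f)
   else True).

Definition smooth_on (U : set V) (f : V -> W) := forall k, Ck_on U k f.

Definition smooth (f : V -> W) := smooth_on setT f.

End Smooth.

Section EuclideanSphere.
Context {R : realType}.

Definition dot {m k} (A B : 'M[R]_(m, k)) : R := \tr (A *m B^T).

Definition sphere (N : nat) : set 'rV[R]_N := [set p | dot p p = 1].

(* Values of Phi off the sphere are irrelevant: smoothness of a map defined on
   the sphere is expressed through a smooth extension to a neighbourhood.  A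
   conformal map has injective differential, so that a smooth conformal
   bijection is automatically a diffeomorphism. *)
Definition conformal_transformation (N : nat) (Phi : 'rV[R]_N -> 'rV[R]_N) :=
  [/\ set_bij (@sphere N) (@sphere N) Phi,
      exists U : set 'rV[R]_N,
        [/\ open U, @sphere N `<=` U & smooth_on U Phi]
    & exists lambda : 'rV[R]_N -> R, forall p, sphere p ->
        0 < lambda p /\
        forall v w, dot v p = 0 -> dot w p = 0 ->
          dot ('D_v Phi p) ('D_w Phi p) = lambda p * dot v w].

End EuclideanSphere.

(* A surface R x S^1 -> S^{N-1} is a map (t, theta) |-> x (t, theta) on R * R
   that is 2 pi-periodic in theta. *)
Section SphericalSurface.
Context {R : realType} {N : nat}.
Implicit Types (x xi : R * R -> 'rV[R]_N) (p : R * R) (a b c d : 'I_2).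

Definition axis a : R * R := if a == 0 then (1, 0) else (0, 1).

Definition partial x a : R * R -> 'rV[R]_N := 'D_(axis a) x.

Definition jac x p : 'M[R]_(2, N) := \matrix_(a < 2) partial x a p.

Definition immersed_surface x :=
  [/\ smooth x,
      forall p, sphere (x p),
      forall t theta, x (t, theta + 2 * pi) = x (t, theta)
    & forall p, row_free (jac x p)].

Definition first_form x p : 'M[R]_2 :=
  \matrix_(a, b) dot (partial x a p) (partial x b p).

Definition first_form_inv x p : 'M[R]_2 := invmx (first_form x p).

(* the fibre at p of the normal bundle of x in the sphere *)
Definition normal_vector x p (v : 'rV[R]_N) :=
  dot v (x p) = 0 /\ forall a, dot v (partial x a p) = 0.

(* orthogonal projection of R^N onto that fibre *)
Definition normal_proj x p (v : 'rV[R]_N) : 'rV[R]_N :=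
  v - dot v (x p) *: x p
    - \sum_a \sum_b
        (first_form_inv x p a b * dot v (partial x a p)) *: partial x b p.

Definition normal_connection x a xi : R * R -> 'rV[R]_N :=
  fun p => normal_proj x p (partial xi a p).

(* The coordinate fields commute, so the curvature of the normal connection is
   determined by the commutator of the two covariant derivatives. *)
Definition flat_normal_bundle x :=
  forall xi, smooth xi -> (forall p, normal_vector x p (xi p)) ->
  forall p, normal_connection x 0 (normal_connection x 1 xi) p =
            normal_connection x 1 (normal_connection x 0 xi) p.

Definition second_form x a b p : 'rV[R]_N :=
  normal_proj x p (partial (partial x a) b p).

Definition mean_curvature x p : 'rV[R]_N :=
  2^-1 *: \sum_a \sum_b first_form_inv x p a b *: second_form x a b p.

Definition tracefree_form x a b p : 'rV[R]_N :=
  second_form x a b p - first_form x p a b *: mean_curvature x p.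

Definition tracefree_normsq x p : R :=
  \sum_a \sum_b \sum_c \sum_d
    first_form_inv x p a c * first_form_inv x p b d *
    dot (tracefree_form x a b p) (tracefree_form x c d p).

Definition area_density x p : R := Num.sqrt (\det (first_form x p)).

Definition willmore_energy (t0 t1 : R) x : R :=
  \int[lebesgue_measure]_(t in `[t0, t1])
    \int[lebesgue_measure]_(theta in `[0, 2 * pi])
      (tracefree_normsq x (t, theta) * area_density x (t, theta)).

(* X s is the surface at time s.  Only the germ at s = 0 matters, so
   reparametrizing s turns any variation defined for small s into one
   parametrized by all of R and consisting of immersions. *)
Definition surface_variation x (t0 t1 : R) (X : R * (R * R) -> 'rV[R]_N) :=
  [/\ smooth X,
      forall s, immersed_surface (fun p => X (s, p)),
      forall p, X (0, p) = x p
    & forall s t theta, t \notin `[t0, t1] -> X (s, (t, theta)) = x (t, theta)].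

Definition willmore x :=
  immersed_surface x /\
  forall (t0 t1 : R) X, surface_variation x t0 t1 X ->
    is_derive (0 : R) (1 : R)
      (fun s => willmore_energy t0 t1 (fun p => X (s, p))) 0.

End SphericalSurface.

(* Complex matrices are turned into real ones by C^k = R^k x R^k; in
   particular dot (real_mx A) (real_mx B) = Re (tr (A adj(B))). *)
Section ComplexMatrix.
Context {R : realType}.

Definition real_mx {m k} (A : 'M[R[i]]_(m, k)) : 'M[R]_(m, k + k) :=
  row_mx (map_mx (@complex.Re R) A) (map_mx (@complex.Im R) A).

Definition complex_mx {m k} (A : 'M[R]_(m, k + k)) : 'M[R[i]]_(m, k) :=
  \matrix_(i, j) (lsubmx A i j +i* rsubmx A i j)%C.

Definition adj {m k} (A : 'M[R[i]]_(m, k)) : 'M[R[i]]_(k, m) :=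
  (map_mx (@conjc R) A)^T.

Definition csmooth {V : normedModType R} {m k} (F : V -> 'M[R[i]]_(m, k)) :=
  smooth (fun v => real_mx (F v)).

Definition velocity {m k} (c : R -> 'M[R[i]]_(m, k)) (t : R) : 'M[R[i]]_(m, k) :=
  complex_mx (derive1 (fun u => real_mx (c u)) t).

Definition cis (theta : R) : R[i] := (cos theta +i* sin theta)%C.

Lemma real_mxK m k : cancel (@real_mx m k) complex_mx.
Proof.
by move=> A; apply/matrixP=> i j; rewrite mxE row_mxKl row_mxKr !mxE; case: (A i j).
Qed.

Lemma complex_mxK m k : cancel (@complex_mx m k) real_mx.
Proof.
move=> A; rewrite -[RHS]hsubmxK; congr row_mx; by apply/matrixP=> i j; rewrite !mxE.
Qed.

Lemma dot_real_mx m k (A B : 'M[R[i]]_(m, k)) :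
  dot (real_mx A) (real_mx B) = complex.Re (\tr (A *m adj B)).
Proof.
rewrite /dot /mxtrace raddf_sum; apply: eq_bigr => i _; rewrite !mxE big_split_ord /=.
rewrite raddf_sum -big_split; apply: eq_bigr => j _; rewrite !mxE.
rewrite !(unsplitK (inl _)) !(unsplitK (inr _)) /= !mxE.
by case: (A i j) (B i j) => a b [c d] /=; rewrite mulrN opprK.
Qed.

Lemma adjK {m k} : cancel (@adj m k) adj.
Proof. by move=> A; apply/matrixP=> i j; rewrite !mxE conjcK. Qed.

Lemma adjM {m k l} (A : 'M[R[i]]_(m, k)) (B : 'M[R[i]]_(k, l)) :
  adj (A *m B) = adj B *m adj A.
Proof. by rewrite /adj map_mxM trmx_mul. Qed.

Lemma adjD {m k} (A B : 'M[R[i]]_(m, k)) : adj (A + B) = adj A + adj B.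
Proof. by rewrite /adj map_mxD linearD. Qed.

Lemma adj0 {m k} : adj (0 : 'M[R[i]]_(m, k)) = 0.
Proof. by rewrite /adj map_mx0 trmx0. Qed.

Lemma adjZ {m k} z (A : 'M[R[i]]_(m, k)) : adj (z *: A) = conjc z *: adj A.
Proof. by rewrite /adj map_mxZ linearZ. Qed.

End ComplexMatrix.

Section Hopf.
Context {R : realType} {n : nat}.
Implicit Types (Z : 'rV[R[i]]_n.+1) (P A : 'M[R[i]]_n.+1).

Definition csphere : set 'rV[R[i]]_n.+1 := [set Z | Z *m adj Z = 1%:M].

(* CP^n is modelled on the rank-one Hermitian projectors, the line C Z being
   represented by the projector Z^* Z with row space C Z.  The fibres of hopf
   over CPn are the S^1-orbits (hopf_fibre below). *)
Definition hopf Z : 'M[R[i]]_n.+1 := adj Z *m Z.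

Definition CPn : set 'M[R[i]]_n.+1 := hopf @` csphere.

(* The factor 1/2 makes hopf a Riemannian submersion (hopf_submersion below). *)
Definition fs_dot (A B : 'M[R[i]]_n.+1) : R :=
  2^-1 * dot (real_mx A) (real_mx B).

(* orthogonal projection of the space of Hermitian matrices onto the tangent
   space of CPn at P *)
Definition tangent_proj P A : 'M[R[i]]_n.+1 :=
  P *m A *m (1%:M - P) + (1%:M - P) *m A *m P.

Definition regular_curve (M : set 'M[R[i]]_n.+1) (g : R -> 'M[R[i]]_n.+1) :=
  [/\ csmooth g, forall t, M (g t) & forall t, velocity g t != 0].

Definition horizontal_lift (g : R -> 'M[R[i]]_n.+1) (c : R -> 'rV[R[i]]_n.+1) :=
  [/\ csmooth c,
      forall t, csphere (c t),
      forall t, hopf (c t) = g t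
    & forall t, dot (real_mx (velocity c t)) (real_mx ('i%C *: c t)) = 0].

Definition hopf_surface (c : R -> 'rV[R[i]]_n.+1) :
    R * R -> 'rV[R]_(n.+1 + n.+1) :=
  fun p => real_mx (cis p.2 *: c p.1).

(* For a complex plane L, given as a row space of rank 2: the sphere S^3 of L
   and the projective line CP^1 of L. *)
Definition csphere_in (L : 'M[R[i]]_(2, n.+1)) : set 'rV[R[i]]_n.+1 :=
  [set Z | csphere Z /\ (Z <= L)%MS].

Definition CP1 (L : 'M[R[i]]_(2, n.+1)) : set 'M[R[i]]_n.+1 :=
  hopf @` csphere_in L.

Definition speed (g : R -> 'M[R[i]]_n.+1) (t : R) : R :=
  Num.sqrt (fs_dot (velocity g t) (velocity g t)).

Definition unit_tangent (g : R -> 'M[R[i]]_n.+1) (t : R) : 'M[R[i]]_n.+1 :=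
  ((speed g t)^-1)%:C%C *: velocity g t.

(* The covariant derivative of the unit tangent with respect to arclength.
   For a curve in CP1 L the derivative of the unit tangent is Hermitian with
   row space in L, on which tangent_proj is the projection onto the tangent
   space of CP1 L; so this is the geodesic curvature vector in CP1 L. *)
Definition curvature_vector (g : R -> 'M[R[i]]_n.+1) (t : R) : 'M[R[i]]_n.+1 :=
  ((speed g t)^-1)%:C%C *: tangent_proj (g t) (velocity (unit_tangent g) t).

Definition geodesic_curvature_sq (g : R -> 'M[R[i]]_n.+1) (t : R) : R :=
  fs_dot (curvature_vector g t) (curvature_vector g t).

Definition elastic_energy (t0 t1 : R) (g : R -> 'M[R[i]]_n.+1) : R :=
  \int[lebesgue_measure]_(t in `[t0, t1])
    ((geodesic_curvature_sq g t + 4) * speed g t).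

Definition curve_variation (M : set 'M[R[i]]_n.+1) (g : R -> 'M[R[i]]_n.+1)
    (t0 t1 : R) (G : R * R -> 'M[R[i]]_n.+1) :=
  [/\ csmooth G,
      forall s, regular_curve M (fun t => G (s, t)),
      forall t, G (0, t) = g t
    & forall s t, t \notin `[t0, t1] -> G (s, t) = g t].

Definition elastic (L : 'M[R[i]]_(2, n.+1)) (g : R -> 'M[R[i]]_n.+1) :=
  regular_curve (CP1 L) g /\
  forall (t0 t1 : R) G, curve_variation (CP1 L) g t0 t1 G ->
    is_derive (0 : R) (1 : R)
      (fun s => elastic_energy t0 t1 (fun t => G (s, t))) 0.

Lemma csphere_real Z : csphere Z <-> sphere (real_mx Z).
Proof.
rewrite /csphere /sphere /= dot_real_mx /mxtrace big_ord1.
have -> : (Z *m adj Z = 1%:M) <-> ((Z *m adj Z) 0 0 = 1).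
  split=> [->|h]; first by rewrite mxE eqxx.
  by apply/matrixP=> i j; rewrite !ord1 h mxE eqxx.
have : complex.Im ((Z *m adj Z) 0 0) = 0.
  rewrite mxE raddf_sum big1 // => j _; rewrite !mxE.
  by case: (Z 0 j) => a b /=; rewrite mulrC mulNr addNr.
by case: ((Z *m adj Z) 0 0) => a b /= ->; split=> [[->]|->].
Qed.

Lemma hopf_fibre Z1 Z2 : csphere Z1 -> csphere Z2 ->
  hopf Z1 = hopf Z2 <-> exists theta, Z2 = cis theta *: Z1.
Proof.
rewrite /csphere /hopf /= => h1 h2; split=> [e|[theta ->]]; last first.
  rewrite adjZ -scalemxAl -scalemxAr scalerA.
  have -> : conjc (cis theta) * cis theta = 1 :> R[i]; last by rewrite scale1r.
  apply/eqP; rewrite eq_complex /=; apply/andP; split; apply/eqP.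
    by rewrite mulNr opprK -!expr2 cos2Dsin2.
  by rewrite mulNr [sin _ * _]mulrC subrr.
have e2 : Z2 = (Z2 *m adj Z1) 0 0 *: Z1.
  rewrite -mul_scalar_mx -mx11_scalar -mulmxA e mulmxA h2.
  by rewrite mul1mx.
move: e2; set l := _ 0 0 => e2.
have : l * conjc l = 1.
  move/matrixP/(_ 0 0): h2; rewrite e2 adjZ -scalemxAl -scalemxAr scalerA h1.
  by rewrite !mxE eqxx mulr1.
move: e2; case: l => a b e2 /eqP; rewrite eq_complex /= => /andP[/eqP hab _].
have {}hab : a ^+ 2 + b ^+ 2 = 1 by rewrite -hab mulrN opprK !expr2.
have a1 : -1 <= a <= 1.
  by rewrite -ler_norml -(@ler_pXn2r _ 2) ?nnegrE// expr1n real_normK ?num_real// -hab lerDl sqr_ge0.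
have sb : sin (acos a) = `|b|.
  by rewrite sin_acos // -hab addrC addKr sqrtr_sqr.
have [b0|b0] := leP 0 b.
  by exists (acos a); rewrite e2 /cis acosK // sb ger0_norm.
by exists (- acos a); rewrite e2 /cis cosN sinN acosK // sb ltr0_norm // opprK.
Qed.

(* adj v *m Z + adj Z *m v is the differential of hopf at Z in the direction v,
   and v *m adj Z = 0 says that v is tangent to the sphere and horizontal. *)
Lemma hopf_submersion Z (v w : 'rV[R[i]]_n.+1) :
  csphere Z -> v *m adj Z = 0 -> w *m adj Z = 0 ->
  fs_dot (adj v *m Z + adj Z *m v) (adj w *m Z + adj Z *m w) =
  dot (real_mx v) (real_mx w).
Proof.
rewrite /csphere /= => hZ hv hw.
have hv' : Z *m adj v = 0 by rewrite -[Z]adjK -adjM hv adj0.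
have hw' : Z *m adj w = 0 by rewrite -[Z]adjK -adjM hw adj0.
rewrite /fs_dot !dot_real_mx adjD !adjM !adjK mulmxDl !mulmxDr.
rewrite !mulmxA -!(mulmxA (adj v)) -!(mulmxA (adj Z)) hw' hZ hv.
rewrite !(mulmx0, mul0mx, mulmx1) addr0 add0r.
rewrite mul1mx mxtraceD [\tr (adj Z *m _)]mxtrace_mulC -!mulmxA hZ mulmx1.
have -> : \tr (adj v *m w) = conjc (\tr (v *m adj w)).
  rewrite mxtrace_mulC -[w *m adj v]adjK adjM adjK /adj mxtrace_tr.
  by rewrite /mxtrace rmorph_sum; apply: eq_bigr => i _; rewrite mxE.
by case: (\tr _) => a b /=; rewrite -mulr2n -[a *+ 2]mulr_natl mulKf.
Qed.

End Hopf.

(* Main.v *)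
Require Import Defs.
From HB Require Import structures.
From mathcomp Require Import all_boot all_order all_algebra.
From mathcomp Require Import complex.
From mathcomp Require Import all_classical all_reals all_analysis.
From mathcomp Require Import ring lra.
Import Order.TTheory GRing.Theory Num.Theory.
Import numFieldNormedType.Exports.
Local Open Scope classical_set_scope.
Local Open Scope ring_scope.

(** Let [x(t, theta) = e^(i theta) c(t)] with [c] a horizontal lift of the
    curve. The field [xi = i x_t] is normal to [x], and it is parallel along the
    fibres because [xi_theta = - x_t] is tangent. Write
    [c'' = - E c + mu c' + u] with [E] the squared length of [c'] and [u]
    orthogonal to the complex plane spanned by [c] and [c']. The normal derivative
    of [xi] along the curve is [e^(i theta) (i u + Re mu i c')], and
    differentiating it along the fibre leaves the normal component
    [- e^(i theta) u]. Flatness of the normal bundle equates this with [0], so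
    that [u = 0] ([flat_osculating]). The Hermitian projector onto the span of [c]
    and [c'] then has zero derivative ([osculating_projector_cst]): [c] stays in a
    fixed complex plane [L]. Hence [x] lies in the 3-sphere of [L] without any
    transformation, and the conformal transformation can be the identity.

    For the second half, let [C] be any lift, horizontal or not, of a curve in the
    projective line of [L], let [V = C' - i phi C] be its horizontal velocity, of
    squared length [v2], and write [C'' = la C + mu V]. The second fundamental form
    of the surface swept out by [C] and the geodesic curvature [k] of the projected
    curve are both functions of [kappa^2 = (Im mu - 2 phi)^2 / v2]: the first has
    trace-free part of squared norm [(kappa^2 + 4) / 2]
    ([hopf_willmore_density]), and [k^2 = kappa^2] ([geodesic_curvature_sq_hopf]).
    Integrating over the fibres, the Willmore energy of the surface is [pi] times
    the elastic energy of the curve ([willmore_energy_hopf]).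

    It remains to lift a compactly supported variation [G] of the curve to a
    variation of the surface with compact support. Horizontal lifts would not do,
    since the holonomy acquired on the support persists after it. Instead [c] is
    projected orthogonally to the varied line, [C = c G / |c G|], which gives back
    [c] wherever the curve is not varied. The projection does not vanish for small
    values of the variation parameter, by compactness ([tube_positive]), and
    replacing [s] by [e sin s] keeps the parameter in that range. Equality of the
    two energies along this variation turns criticality of the surface into
    criticality of the curve ([willmore_elastic]).

    Smoothness is given by iterated directional derivatives, so the composite maps
    above need a chain rule for functions of two variables. It rests on the
    differentiability of functions with continuous directional derivatives
    ([C1_differentiable]). *)

Set Implicit Arguments.
Unset Strict Implicit.
Unset Printing Implicit Defensive.

(** * Directional derivatives and the chain rule *)

Section DirectionalChainRule.
Context {R : realType}.

Lemma derive1_shift (V W : normedModType R) (f : V -> W) p v :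
  'D_v f p = 'D_1 (fun t : R => f (t *: v + p)) 0.
Proof.
rewrite /derive; set g1 := fun h => h^-1 *: _; set g2 := fun h => h^-1 *: _.
suff -> : g1 = g2 by [].
by apply/funext => h; rewrite /g1 /g2 /= addr0 scale0r add0r [_%:A]mulr1.
Qed.

Lemma is_derive_line (V W : normedModType R) (f : V -> W) v (l : R -> V) t :
  derivable f (l t) v -> (forall h, l (h + t) = h *: v + l t) ->
  is_derive t (1 : R) (f \o l) ('D_v f (l t)).
Proof.
move=> df lE.
have E : (fun h : R => (f \o l) (h *: 1 + t)) = fun h => f (h *: v + l t).
  by apply/funext => h; rewrite /= [_ *: 1]mulr1 lE.
apply: DeriveDef.
  by apply: (derivable1P _ _ _).2; rewrite E; apply: (derivable1P _ _ _).1.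
by rewrite [LHS]derive1_shift E -derive1_shift.
Qed.

Lemma is_derive_comp_diff (V U W : normedModType R) (G : U -> W) (h : V -> U)
    p v dh :
  differentiable G (h p) -> is_derive p v h dh ->
  is_derive p v (G \o h) ('d G (h p) dh).
Proof.
move=> dG [dh1 dh2].
have d1 : differentiable (fun t : R => h (t *: v + p)) 0.
  by apply/derivable1_diffP; apply: (derivable1P _ _ _).1.
have e0 : h (0 *: v + p) = h p by rewrite scale0r add0r.
have dG' : differentiable G ((fun t : R => h (t *: v + p)) 0) by rewrite e0.
have d2 := differentiable_comp d1 dG'.
apply: DeriveDef; first by apply: (derivable1P _ _ _).2; apply/derivable1_diffP.
rewrite derive1_shift (_ : (fun _ => _) = G \o (fun t : R => h (t *: v + p)))//.
rewrite deriveE // diff_comp //= e0; congr ('d G _ _).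
by rewrite -deriveE // -derive1_shift.
Qed.

Lemma MVT_signed (f df : R -> R) (a h : R) :
  (forall x, is_derive x (1 : R) f (df x)) ->
  exists2 c, `|c - a| <= `|h| & f (h + a) - f a = df c * h.
Proof.
move=> fd.
have fc : continuous f.
  by move=> x; apply/differentiable_continuous/derivable1_diffP; case: (fd x).
have mvt u w : u <= w -> exists2 c, c \in `[u, w]%R & f w - f u = df c * (w - u).
  move=> uw; apply: MVT_segment => //; exact: continuous_subspaceT.
have [h0|h0] := leP 0 h.
  have [|c] := mvt a (h + a); first by rewrite lerDr.
  rewrite in_itv /= => /andP[ac ca] e; exists c; last by rewrite e addrK.
  by rewrite !ger0_norm ?subr_ge0// lerBlDr.
have [|c] := mvt (h + a) a; first by rewrite gerDr ltW.
rewrite in_itv /= => /andP[ac ca] e; exists c.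
  by rewrite (ltr0_norm h0) ler0_norm ?subr_le0// lerN2 lerBrDr.
by rewrite -opprB e; ring.
Qed.

(** Moving first along the second axis and then along the first one, the mean
    value theorem expresses an increment of [F] by partial derivatives at nearby
    points, so their continuity makes the error term small. *)
Lemma C1_differentiable (F : R * R -> R) x :
  (forall v p, derivable F p v) -> (forall v, continuous ('D_v F)) ->
  is_diff x F (fun h => h.1 * 'D_(1, 0) F x + h.2 * 'D_(0, 1) F x).
Proof.
move=> dF cF; set x1 := x.1; set x2 := x.2.
have xE : x = (x1, x2) by rewrite /x1 /x2; case: (x).
have ring_id (a b a' b' k1 k2 : R) :
  a' * k1 + b' * k2 - (k1 * a + k2 * b) = - ((a - a') * k1 + (b - b') * k2).
  by ring.
have lin (a b : R) : linear (fun h : R * R => h.1 * a + h.2 * b).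
  by move=> k u w /=; rewrite !mulrDl -!scalerAl scalerDr addrACA.
pose L (h : R * R) := h.1 * 'D_(1, 0) F x + h.2 * 'D_(0, 1) F x.
have lin_L : linear L := lin _ _.
pose LM := GRing.isLinear.Build _ _ _ _ _ lin_L.
pose LL : {linear (R * R)%type -> R} := HB.pack L LM.
have cL : continuous L.
  move=> h; apply: cvgD; apply: cvgM; try exact: cvg_cst.
    exact: cvg_fst.
  exact: cvg_snd.
have FL : F \o shift x = cst (F x) + L +o_ 0 id.
  apply/eqaddoP => e e0.
  have e20 : 0 < e / 2 by rewrite divr_gt0.
  have /cvgrPdist_le/(_ _ e20)/nbhs_ballP[d1 d10 b1] := cF (1, 0) x.
  have /cvgrPdist_le/(_ _ e20)/nbhs_ballP[d2 d20 b2] := cF (0, 1) x.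
  apply/nbhs_ballP; exists (Num.min d1 d2) => /=; first by rewrite lt_min d10.
  move=> -[h1 h2] [/=]; rewrite -!ball_normE /= !sub0r !normrN !lt_min.
  move=> /andP[h1d1 h1d2] /andP[h2d1 h2d2].
  have [c1 c1h e1] : exists2 c, `|c - x1| <= `|h1| &
      F (h1 + x1, h2 + x2) - F (x1, h2 + x2) = 'D_(1, 0) F (c, h2 + x2) * h1.
    apply: (@MVT_signed (fun y => F (y, h2 + x2))
              (fun y => 'D_(1, 0) F (y, h2 + x2))) => y.
    apply: (is_derive_line (l := fun y => (y, h2 + x2))) => // h.
    by rewrite [RHS](_ : _ = (h * 1 + y, h * 0 + (h2 + x2)))// mulr1 mulr0 add0r.
  have [c2 c2h e2] : exists2 c, `|c - x2| <= `|h2| &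
      F (x1, h2 + x2) - F (x1, x2) = 'D_(0, 1) F (x1, c) * h2.
    apply: (@MVT_signed (fun y => F (x1, y))
              (fun y => 'D_(0, 1) F (x1, y))) => y.
    apply: (is_derive_line (l := fun y => (x1, y))) => // h.
    by rewrite [RHS](_ : _ = (h * 0 + x1, h * 1 + y))// mulr1 mulr0 add0r.
  have B1 : `|'D_(1, 0) F x - 'D_(1, 0) F (c1, h2 + x2)| <= e / 2.
    apply: b1; split; rewrite /ball /= distrC.
      exact: le_lt_trans h1d1.
    by rewrite addrK.
  have B2 : `|'D_(0, 1) F x - 'D_(0, 1) F (x1, c2)| <= e / 2.
    apply: b2; split; rewrite /ball /= ?subrr ?normr0 // distrC.
    exact: le_lt_trans h2d2.
  set N := `|(h1, h2)|.
  have N1 : `|h1| <= N by rewrite /N prod_normE /= le_max lexx.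
  have N2 : `|h2| <= N by rewrite /N prod_normE /= le_max lexx orbT.
  have -> : (F \o shift x - (cst (F x) + L)) (h1, h2) =
     - (('D_(1, 0) F x - 'D_(1, 0) F (c1, h2 + x2)) * h1
     + ('D_(0, 1) F x - 'D_(0, 1) F (x1, c2)) * h2).
    transitivity (F (h1 + x1, h2 + x2) - (F (x1, x2) + L (h1, h2))).
      by rewrite -xE.
    rewrite opprD addrA -[F _ - F _](subrKA (F (x1, h2 + x2))) e1 e2 /L /=.
    by rewrite ring_id.
  rewrite normrN (le_trans (ler_normD _ _))// !normrM.
  by rewrite [in leRHS](splitr e) mulrDl; apply: lerD; apply: ler_pM.
have dE : 'd F x = LL :> (_ -> _) by apply: diff_unique.
by apply: DiffDef => //; apply/diff_locallyP; rewrite dE.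
Qed.

End DirectionalChainRule.

(** * Smooth real functions *)

Section SmoothCalculus.
Context {R : realType}.

Local Notation Ck k f := (Ck_on setT k f).

Lemma CkSP (V W : normedModType R) k (f : V -> W) :
  Ck k.+1 f <->
  continuous f /\ forall v, (forall p, derivable f p v) /\ Ck k ('D_v f).
Proof.
split=> [[cf df]|[cf df]]; split.
- by move=> p; exact: cf.
- by move=> v; have [d1 d2] := df v; split=> // p; exact: d1.
- by move=> p _; exact: cf.
- by move=> v; have [d1 d2] := df v; split=> // p _; exact: d1.
Qed.

Lemma Ck_continuous (V W : normedModType R) k (f : V -> W) :
  Ck k f -> continuous f.
Proof. by case: k => [|k] [cf _] p; exact: cf. Qed.

Lemma Ck0 (V W : normedModType R) (f : V -> W) : continuous f -> Ck 0 f.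
Proof. by move=> cf; split=> // p _; exact: cf. Qed.

Lemma CkW (V W : normedModType R) k (f : V -> W) : Ck k.+1 f -> Ck k f.
Proof.
elim: k f => [|k IH] f /CkSP[cf df]; first exact: Ck0.
by apply/CkSP; split=> // v; have [d1 d2] := df v; split=> //; exact: IH.
Qed.

Lemma Ck_is_derive (V W : normedModType R) k (f : V -> W) p v :
  Ck k.+1 f -> is_derive p v f ('D_v f p).
Proof. by move=> /CkSP[_ df]; apply: derivableP; exact: (df v).1. Qed.

(** Closure properties are proved by induction on the order of differentiability:
    it is enough to exhibit a derivative in each direction, and its regularity. *)
Lemma Ck_succ (V W : normedModType R) k (f : V -> W) (df : V -> V -> W) :
  continuous f -> (forall v, Ck k (df v)) ->
  (forall v p, is_derive p v f (df v p)) -> Ck k.+1 f.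
Proof.
move=> cf dfk fd; apply/CkSP; split=> // v; split=> [p|].
  by case: (fd v p).
rewrite (_ : 'D_v f = df v)//; apply/funext => p.
exact: (@derive_val _ _ _ _ _ _ _ (fd v p)).
Qed.

Lemma smooth_continuous (V W : normedModType R) (f : V -> W) :
  smooth f -> continuous f.
Proof. by move/(_ 0%N); exact: Ck_continuous. Qed.

Lemma smooth_is_derive (V W : normedModType R) (f : V -> W) p v :
  smooth f -> is_derive p v f ('D_v f p).
Proof. by move/(_ 1%N)/Ck_is_derive. Qed.

Lemma smooth_derive (V W : normedModType R) (f : V -> W) v :
  smooth f -> smooth ('D_v f).
Proof. by move=> sf k; have /CkSP[_ /(_ v)[]] := sf k.+1. Qed.

Lemma smooth_cst (V W : normedModType R) (a : W) : smooth (fun _ : V => a).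
Proof.
move=> k; elim: k a => [|k IH] a; first by apply: Ck0; exact: cst_continuous.
apply: (@Ck_succ _ _ _ _ (fun _ _ => 0)).
- exact: cst_continuous.
- by move=> v; exact: IH.
Qed.

Lemma smooth_lin (V W : normedModType R) (f : {linear V -> W}) :
  continuous f -> smooth f.
Proof.
move=> cf [|k]; first exact: Ck0.
apply: (@Ck_succ _ _ _ _ (fun v _ => f v)) => // [v|v p]; first exact: smooth_cst.
have df : differentiable f p by exact: linear_differentiable.
apply: DeriveDef; first exact: diff_derivable.
by rewrite deriveE // diff_lin.
Qed.

Lemma CkD (V W : normedModType R) k (f g : V -> W) :
  Ck k f -> Ck k g -> Ck k (fun p => f p + g p).
Proof.
elim: k f g => [|k IH] f g sf sg.
  apply: Ck0 => p; apply: cvgD; [exact: (Ck_continuous sf)|].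
  exact: (Ck_continuous sg).
apply: (@Ck_succ _ _ _ _ (fun v p => 'D_v f p + 'D_v g p)).
- move=> p; apply: cvgD; [exact: (Ck_continuous sf)|].
  exact: (Ck_continuous sg).
- move=> v; move/CkSP: sf => [_ /(_ v)[_ sf]]; move/CkSP: sg => [_ /(_ v)[_ sg]].
  exact: IH.
- move=> v p; have fd := Ck_is_derive p v sf; have gd := Ck_is_derive p v sg.
  exact: is_deriveD.
Qed.

Lemma CkM (V : normedModType R) k (f g : V -> R) :
  Ck k f -> Ck k g -> Ck k (fun p => f p * g p).
Proof.
elim: k f g => [|k IH] f g sf sg.
  apply: Ck0 => p; apply: cvgM; [exact: (Ck_continuous sf)|].
  exact: (Ck_continuous sg).
apply: (@Ck_succ _ _ _ _ (fun v p => f p * 'D_v g p + g p * 'D_v f p)).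
- move=> p; apply: cvgM; [exact: (Ck_continuous sf)|].
  exact: (Ck_continuous sg).
- move=> v; have sf' := CkW sf; have sg' := CkW sg.
  move/CkSP: sf => [_ /(_ v)[_ sf]]; move/CkSP: sg => [_ /(_ v)[_ sg]].
  by apply: CkD; apply: IH.
- move=> v p; have fd := Ck_is_derive p v sf; have gd := Ck_is_derive p v sg.
  exact: is_deriveM.
Qed.

Lemma smoothD (V W : normedModType R) (f g : V -> W) :
  smooth f -> smooth g -> smooth (fun p => f p + g p).
Proof. by move=> sf sg k; apply: CkD. Qed.

Lemma smoothM (V : normedModType R) (f g : V -> R) :
  smooth f -> smooth g -> smooth (fun p => f p * g p).
Proof. by move=> sf sg k; apply: CkM. Qed.

Lemma smoothN (V : normedModType R) (f : V -> R) :
  smooth f -> smooth (fun p => - f p).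
Proof.
move=> sf; rewrite (_ : (fun _ => _) = fun p => -1 * f p).
  by apply: smoothM => //; exact: smooth_cst.
by apply/funext => p; rewrite mulN1r.
Qed.

Lemma smooth_sum (V : normedModType R) (I : Type) (r : seq I)
    (F : I -> V -> R) :
  (forall i, smooth (F i)) -> smooth (fun p => \sum_(i <- r) F i p).
Proof.
move=> sF; elim: r => [|i r IH].
  rewrite (_ : (fun _ => _) = fun=> 0); first exact: smooth_cst.
  by apply/funext => p; rewrite big_nil.
rewrite (_ : (fun _ => _) = fun p => F i p + \sum_(j <- r) F j p).
  exact: smoothD.
by apply/funext => p; rewrite big_cons.
Qed.

Lemma is_derive_comp1 (V : normedModType R) (phi : R -> R) (h : V -> R) p v a dh :
  is_derive (h p) (1 : R) phi a -> is_derive p v h dh ->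
  is_derive p v (fun q => phi (h q)) (dh * a).
Proof.
move=> [dphi <-] hd.
have df : differentiable phi (h p) by exact/derivable1_diffP.
have -> : dh * 'D_1 phi (h p) = 'd phi (h p) dh by rewrite (diff1E df) derive1E.
exact: is_derive_comp_diff.
Qed.

Lemma Ck_inv (V : normedModType R) k (f : V -> R) :
  (forall p, f p != 0) -> Ck k f -> Ck k (fun p => (f p)^-1).
Proof.
move=> f0; elim: k => [|k IH] sf.
  apply: Ck0 => p; apply: cvgV => //; exact: (Ck_continuous sf).
apply: (@Ck_succ _ _ _ _ (fun v p => - ((f p)^-1 * (f p)^-1) * 'D_v f p)).
- move=> p; apply: cvgV => //; exact: (Ck_continuous sf).
- move=> v; have sf' := IH (CkW sf).
  move/CkSP: sf => [_ /(_ v)[_ sf]]; apply: CkM => //.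
  rewrite (_ : (fun _ => _) = fun p => -1 * ((f p)^-1 * (f p)^-1)).
    by apply: CkM; [exact: smooth_cst|exact: CkM].
  by apply/funext => p; rewrite mulN1r.
- move=> v p; have fd := Ck_is_derive p v sf.
  have [d1 _] := fd.
  apply: DeriveDef; first exact: derivableV.
  by rewrite deriveV // -expr2 exprVn.
Qed.

Lemma smoothV (V : normedModType R) (f : V -> R) :
  (forall p, f p != 0) -> smooth f -> smooth (fun p => (f p)^-1).
Proof. by move=> f0 sf k; apply: Ck_inv. Qed.

Lemma smooth_sqrt (V : normedModType R) (f : V -> R) :
  (forall p, 0 < f p) -> smooth f -> smooth (fun p => Num.sqrt (f p)).
Proof.
move=> f0 sf k.
have cf : continuous (fun p => Num.sqrt (f p)).
  move=> p; apply: (@continuous_comp _ _ _ f Num.sqrt).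
    exact: smooth_continuous.
  exact: sqrt_continuous.
elim: k => [|k IH]; first exact: Ck0.
apply: (@Ck_succ _ _ _ _ (fun v p => 'D_v f p * (2 * Num.sqrt (f p))^-1)) => //.
- move=> v; apply: CkM; first exact: smooth_derive.
  apply: Ck_inv; first by move=> p; rewrite mulf_neq0 // gt_eqF // sqrtr_gt0.
  by apply: CkM => //; exact: smooth_cst.
- move=> v p; apply: is_derive_comp1; last exact: smooth_is_derive.
  exact: is_derive1_sqrt.
Qed.

Lemma smooth_trig (V : normedModType R) (f : V -> R) : smooth f ->
  smooth (fun p => cos (f p)) /\ smooth (fun p => sin (f p)).
Proof.
move=> sf.
have cc : continuous (fun p => cos (f p)).
  move=> p; apply: (@continuous_comp _ _ _ f cos); first exact: smooth_continuous.
  exact: continuous_cos.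
have cs : continuous (fun p => sin (f p)).
  move=> p; apply: (@continuous_comp _ _ _ f sin); first exact: smooth_continuous.
  exact: continuous_sin.
suff H k : Ck k (fun p => cos (f p)) /\ Ck k (fun p => sin (f p)).
  by split=> k; have [] := H k.
elim: k => [|k [IHc IHs]]; first by split; exact: Ck0.
split.
- apply: (@Ck_succ _ _ _ _ (fun v p => 'D_v f p * (- sin (f p)))) => //.
    move=> v; apply: CkM; first exact: smooth_derive.
    rewrite (_ : (fun _ => _) = fun p => -1 * sin (f p)).
      by apply: CkM => //; exact: smooth_cst.
    by apply/funext => p; rewrite mulN1r.
  move=> v p; exact: (is_derive_comp1 (is_derive_cos (f p)) (smooth_is_derive p v sf)).
- apply: (@Ck_succ _ _ _ _ (fun v p => 'D_v f p * cos (f p))) => //.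
    by move=> v; apply: CkM => //; exact: smooth_derive.
  move=> v p; exact: (is_derive_comp1 (is_derive_sin (f p)) (smooth_is_derive p v sf)).
Qed.

Lemma smooth_comp1 (V : normedModType R) (phi : R -> R) (h : V -> R) :
  smooth phi -> smooth h -> smooth (fun p => phi (h p)).
Proof.
move=> sphi sh k; elim: k phi sphi => [|k IH] phi sphi.
  by apply: Ck0 => p; apply: (@continuous_comp _ _ _ h phi);
    exact: smooth_continuous.
apply: (@Ck_succ _ _ _ _ (fun v p => 'D_v h p * 'D_1 phi (h p))).
- by move=> p; apply: (@continuous_comp _ _ _ h phi); exact: smooth_continuous.
- by move=> v; apply: CkM; [exact: smooth_derive|exact: (IH _ (smooth_derive _ sphi))].
- move=> v p.
  exact: (is_derive_comp1 (smooth_is_derive _ _ sphi) (smooth_is_derive p v sh)).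
Qed.

Lemma is_derive_pair (V : normedModType R) (h1 h2 : V -> R) p v d1 d2 :
  is_derive p v h1 d1 -> is_derive p v h2 d2 ->
  is_derive p v (fun q => (h1 q, h2 q)) (d1, d2).
Proof.
move=> [dh1 e1] [dh2 e2].
have c1 : h^-1 *: (h1 (h *: v + p) - h1 p) @[h --> 0^'] --> d1 by rewrite -e1; exact: dh1.
have c2 : h^-1 *: (h2 (h *: v + p) - h2 p) @[h --> 0^'] --> d2 by rewrite -e2; exact: dh2.
have c := cvg_pair c1 c2.
apply: DeriveDef; first by apply/cvg_ex; exists (d1, d2); exact: c.
by apply: cvg_lim; [exact: norm_hausdorff|exact: c].
Qed.

(** A directional derivative of the composite is a combination of composites with
    the partial derivatives of [F]; hence the induction on the order has to range
    over all smooth [F]. *)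
Lemma smooth_comp2 (V : normedModType R) (F : R * R -> R) (h1 h2 : V -> R) :
  smooth F -> smooth h1 -> smooth h2 -> smooth (fun p => F (h1 p, h2 p)).
Proof.
move=> sF s1 s2 k.
have cF (G : R * R -> R) : smooth G -> continuous (fun p => G (h1 p, h2 p)).
  move=> sG p; apply: (@continuous_comp _ _ _ (fun p => (h1 p, h2 p)) G).
    have c1 : h1 q @[q --> p] --> h1 p by exact: smooth_continuous.
    have c2 : h2 q @[q --> p] --> h2 p by exact: smooth_continuous.
    have c := cvg_pair c1 c2; exact: c.
  exact: smooth_continuous.
elim: k F sF => [|k IH] F sF; first by apply: Ck0; exact: cF.
apply: (@Ck_succ _ _ _ _ (fun v p =>
  'D_v h1 p * 'D_(1, 0) F (h1 p, h2 p) + 'D_v h2 p * 'D_(0, 1) F (h1 p, h2 p))).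
- exact: cF.
- move=> v; have sD (w : R * R) : smooth ('D_w F) by exact: smooth_derive.
  have A := CkM (smooth_derive v s1 k) (IH _ (sD (1, 0))).
  have B := CkM (smooth_derive v s2 k) (IH _ (sD (0, 1))).
  exact: (CkD A B).
- move=> v p.
  have dF w q : derivable F q w by case: (smooth_is_derive q w sF).
  have cdF w : continuous ('D_w F) by exact/smooth_continuous/smooth_derive.
  have [dFp dFE] := C1_differentiable (h1 p, h2 p) dF cdF.
  have hd := is_derive_pair (smooth_is_derive p v s1) (smooth_is_derive p v s2).
  have := is_derive_comp_diff dFp hd.
  by rewrite dFE.
Qed.

Lemma smooth_mxP (V : normedModType R) m k (F : V -> 'M[R]_(m, k)) :
  smooth F <-> forall i j, smooth (fun p => F p i j).
Proof.
have dE v (G : V -> 'M[R]_(m, k)) : (forall p, derivable G p v) ->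
    forall i j, 'D_v (fun p => G p i j) = (fun p => 'D_v G p i j).
  by move=> dG i j; apply/funext => p; rewrite derive_mx // mxE.
split=> [sF i j l|sF l].
  elim: l F sF => [|l IH] F sF.
    apply: Ck0 => p.
    apply: (@continuous_comp _ _ _ F (fun M : 'M[R]_(m, k) => M i j)).
      exact: smooth_continuous.
    exact: coord_continuous.
  have dF v p : derivable F p v by case: (smooth_is_derive p v sF).
  apply/CkSP; split; first by apply: Ck_continuous (IH F sF).
  move=> v; split=> [p|]; first exact: (derivable_mxP _ _ _).1.
  by rewrite dE //; apply: IH; exact: smooth_derive.
elim: l F sF => [|l IH] F sF.
  apply: Ck0 => p; apply/cvgrPdist_le => /= e e0; near=> q.
  rewrite [leLHS]/Num.Def.normr/= mx_normrE (bigmax_le _ (ltW e0))//= => i _.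
  rewrite !mxE/=; move: i; near: q; apply: filter_forall => /= i.
  have c : continuous (fun q => F q i.1 i.2) by exact: smooth_continuous.
  by have /cvgrPdist_le/(_ _ e0) := c p.
have dF v p : derivable F p v.
  by apply/derivable_mxP => i j; case: (smooth_is_derive p v (sF i j)).
apply/CkSP; split; first exact: Ck_continuous (IH F sF).
move=> v; split=> //; apply: IH => i j; rewrite -dE //; exact: smooth_derive.
Unshelve. all: by end_near. Qed.

End SmoothCalculus.

(** * Smooth functions with complex matrix values *)

Section ComplexNumbers.
Context {R : realType}.
Implicit Types z w : R[i].

Lemma ReM z w : complex.Re (z * w) =
  complex.Re z * complex.Re w - complex.Im z * complex.Im w.
Proof. by case: z w => a b [c d]. Qed.

Lemma ImM z w : complex.Im (z * w) =
  complex.Re z * complex.Im w + complex.Im z * complex.Re w.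
Proof. by case: z w => a b [c d]. Qed.

Lemma ReD z w : complex.Re (z + w) = complex.Re z + complex.Re w.
Proof. by case: z w => a b [c d]. Qed.

Lemma ImD z w : complex.Im (z + w) = complex.Im z + complex.Im w.
Proof. by case: z w => a b [c d]. Qed.

Lemma ReN z : complex.Re (- z) = - complex.Re z. Proof. by case: z. Qed.
Lemma ImN z : complex.Im (- z) = - complex.Im z. Proof. by case: z. Qed.

Lemma Re_conjc z : complex.Re (conjc z) = complex.Re z.
Proof. by case: z. Qed.

Lemma Im_conjc z : complex.Im (conjc z) = - complex.Im z.
Proof. by case: z. Qed.

Lemma complex_eqP z w :
  complex.Re z = complex.Re w -> complex.Im z = complex.Im w -> z = w.
Proof. by case: z w => a b [c d] /= -> ->. Qed.

Lemma cis_conjc theta : cis theta * conjc (cis theta) = 1 :> R[i].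
Proof.
apply: complex_eqP; rewrite /cis /=; last by rewrite mulrN mulrC addNr.
by rewrite mulrN opprK -!expr2 cos2Dsin2.
Qed.

End ComplexNumbers.

Section ComplexSmooth.
Context {R : realType} {V : normedModType R}.

Definition complex_smooth (f : V -> R[i]) :=
  smooth (fun p => complex.Re (f p)) /\ smooth (fun p => complex.Im (f p)).

Lemma csmoothP m k (F : V -> 'M[R[i]]_(m, k)) :
  csmooth F <-> forall i j, complex_smooth (fun p => F p i j).
Proof.
split=> [/smooth_mxP sF i j|sF].
  split.
    have := sF i (lshift k j); congr smooth; apply/funext => p.
    by rewrite row_mxEl mxE.
  have := sF i (rshift k j); congr smooth; apply/funext => p.
  by rewrite row_mxEr mxE.
apply/smooth_mxP => i j; case: (split_ordP j) => l ->.
  have := (sF i l).1; congr smooth; apply/funext => p.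
  by rewrite row_mxEl mxE.
have := (sF i l).2; congr smooth; apply/funext => p.
by rewrite row_mxEr mxE.
Qed.

Lemma complex_smooth_cst z : complex_smooth (fun=> z).
Proof. by split; exact: smooth_cst. Qed.

Lemma complex_smooth_real (f : V -> R) :
  smooth f -> complex_smooth (fun p => (f p)%:C%C).
Proof. by move=> sf; split=> //=; exact: smooth_cst. Qed.

Lemma complex_smoothD (f g : V -> R[i]) :
  complex_smooth f -> complex_smooth g -> complex_smooth (fun p => f p + g p).
Proof.
move=> [f1 f2] [g1 g2]; split.
  have := smoothD f1 g1; congr smooth; apply/funext => p; by rewrite raddfD.
have := smoothD f2 g2; congr smooth; apply/funext => p; by rewrite raddfD.
Qed.

Lemma complex_smoothM (f g : V -> R[i]) :
  complex_smooth f -> complex_smooth g -> complex_smooth (fun p => f p * g p).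
Proof.
move=> [f1 f2] [g1 g2]; split.
  have := smoothD (smoothM f1 g1) (smoothN (smoothM f2 g2)).
  by congr smooth; apply/funext => p; rewrite ReM.
have := smoothD (smoothM f1 g2) (smoothM f2 g1).
by congr smooth; apply/funext => p; rewrite ImM.
Qed.

Lemma complex_smooth_conj (f : V -> R[i]) :
  complex_smooth f -> complex_smooth (fun p => conjc (f p)).
Proof.
move=> [f1 f2]; split.
  by have := f1; congr smooth; apply/funext => p; rewrite Re_conjc.
by have := smoothN f2; congr smooth; apply/funext => p; rewrite Im_conjc.
Qed.

Lemma complex_smooth_sum I (r : seq I) (F : I -> V -> R[i]) :
  (forall i, complex_smooth (F i)) ->
  complex_smooth (fun p => \sum_(i <- r) F i p).
Proof.
move=> sF; split.
  have := smooth_sum r (fun i => (sF i).1); congr smooth; apply/funext => p.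
  by rewrite raddf_sum.
have := smooth_sum r (fun i => (sF i).2); congr smooth; apply/funext => p.
by rewrite raddf_sum.
Qed.

Lemma complex_smooth_cis (f : V -> R) :
  smooth f -> complex_smooth (fun p => cis (f p)).
Proof. by move=> /smooth_trig. Qed.

Lemma csmoothD m k (F G : V -> 'M[R[i]]_(m, k)) :
  csmooth F -> csmooth G -> csmooth (fun p => F p + G p).
Proof.
move=> /csmoothP sF /csmoothP sG; apply/csmoothP => i j.
have := complex_smoothD (sF i j) (sG i j); congr complex_smooth.
by apply/funext => p; rewrite mxE.
Qed.

Lemma csmoothZ m k (a : V -> R[i]) (F : V -> 'M[R[i]]_(m, k)) :
  complex_smooth a -> csmooth F -> csmooth (fun p => a p *: F p).
Proof.
move=> sa /csmoothP sF; apply/csmoothP => i j.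
have := complex_smoothM sa (sF i j); congr complex_smooth.
by apply/funext => p; rewrite mxE.
Qed.

Lemma csmooth_mulmx m k l (F : V -> 'M[R[i]]_(m, k)) (G : V -> 'M[R[i]]_(k, l)) :
  csmooth F -> csmooth G -> csmooth (fun p => F p *m G p).
Proof.
move=> /csmoothP sF /csmoothP sG; apply/csmoothP => i j.
have := complex_smooth_sum (index_enum 'I_k)
  (fun s => complex_smoothM (sF i s) (sG s j)).
by congr complex_smooth; apply/funext => p; rewrite mxE.
Qed.

Lemma csmooth_adj m k (F : V -> 'M[R[i]]_(m, k)) :
  csmooth F -> csmooth (fun p => adj (F p)).
Proof.
move=> /csmoothP sF; apply/csmoothP => i j.
have := complex_smooth_conj (sF j i); congr complex_smooth.
by apply/funext => p; rewrite !mxE.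
Qed.

End ComplexSmooth.

Section ComplexDerivative.
Context {R : realType} {V : normedModType R}.
Implicit Types (p v : V).

Definition is_cderive p v (f : V -> R[i]) (df : R[i]) :=
  is_derive p v (fun q => complex.Re (f q)) (complex.Re df) /\
  is_derive p v (fun q => complex.Im (f q)) (complex.Im df).

Definition is_mxderive m k p v (F : V -> 'M[R[i]]_(m, k)) (dF : 'M[R[i]]_(m, k)) :=
  is_derive p v (fun q => real_mx (F q)) (real_mx dF).

Lemma is_mxderiveP m k p v (F : V -> 'M[R[i]]_(m, k)) (dF : 'M[R[i]]_(m, k)) :
  is_mxderive p v F dF <->
  forall i j, is_cderive p v (fun q => F q i j) (dF i j).
Proof.
have El i j : (fun q => real_mx (F q) i (lshift k j)) =
    (fun q => complex.Re (F q i j)).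
  by apply/funext => q; rewrite row_mxEl mxE.
have Er i j : (fun q => real_mx (F q) i (rshift k j)) =
    (fun q => complex.Im (F q i j)).
  by apply/funext => q; rewrite row_mxEr mxE.
split=> [[dr de] i j|dF'].
  have dr' := (derivable_mxP _ _ _).1 dr.
  have dx l : is_derive p v (fun q => real_mx (F q) i l) (real_mx dF i l).
    by apply: DeriveDef => //; rewrite -de derive_mx // mxE.
  split.
    by have := dx (lshift k j); rewrite El row_mxEl mxE.
  by have := dx (rshift k j); rewrite Er row_mxEr mxE.
have dr : derivable (fun q => real_mx (F q)) p v.
  apply/derivable_mxP => i j; case: (split_ordP j) => l ->.
    by rewrite El; case: (dF' i l).1.
  by rewrite Er; case: (dF' i l).2.
apply: DeriveDef => //; rewrite derive_mx //; apply/matrixP => i j.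
rewrite mxE; case: (split_ordP j) => l ->.
  by rewrite El row_mxEl mxE; case: (dF' i l).1.
by rewrite Er row_mxEr mxE; case: (dF' i l).2.
Qed.

Lemma is_mxderive_eq m k p v (F : V -> 'M[R[i]]_(m, k)) dF dF' :
  is_mxderive p v F dF -> dF = dF' -> is_mxderive p v F dF'.
Proof. by move=> h <-. Qed.

Lemma is_cderive_cst p v z : is_cderive p v (fun=> z) 0.
Proof. by split; exact: is_derive_cst. Qed.

Lemma is_cderive_cst_eq0 p v z df : is_cderive p v (fun=> z) df -> df = 0.
Proof.
by move=> [[_ er] [_ ei]]; apply: complex_eqP; rewrite -?er -?ei derive_cst.
Qed.

Lemma is_cderiveD p v f g df dg : is_cderive p v f df -> is_cderive p v g dg ->
  is_cderive p v (fun q => f q + g q) (df + dg).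
Proof.
move=> [f1 f2] [g1 g2]; split; rewrite raddfD.
  have := is_deriveD f1 g1; congr is_derive.
  by apply/funext => q; rewrite [RHS]raddfD.
have := is_deriveD f2 g2; congr is_derive.
by apply/funext => q; rewrite [RHS]raddfD.
Qed.

Lemma is_cderiveM p v f g df dg : is_cderive p v f df -> is_cderive p v g dg ->
  is_cderive p v (fun q => f q * g q) (df * g p + f p * dg).
Proof.
move=> [f1 f2] [g1 g2]; split.
  have := is_deriveB (is_deriveM f1 g1) (is_deriveM f2 g2).
  congr is_derive; first by apply/funext => q; rewrite [RHS]ReM.
  by rewrite ReD !ReM /GRing.scale /=; ring.
have := is_deriveD (is_deriveM f1 g2) (is_deriveM f2 g1).
congr is_derive; first by apply/funext => q; rewrite [RHS]ImM.
by rewrite ImD !ImM /GRing.scale /=; ring.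
Qed.

Lemma is_cderive_conj p v f df :
  is_cderive p v f df -> is_cderive p v (fun q => conjc (f q)) (conjc df).
Proof.
move=> [f1 f2]; split.
  rewrite Re_conjc; have := f1; congr is_derive.
  by apply/funext => q; rewrite Re_conjc.
rewrite Im_conjc; have := is_deriveN f2; congr is_derive.
by apply/funext => q; rewrite Im_conjc.
Qed.

Lemma is_cderive_sum p v I (r : seq I) (F : I -> V -> R[i]) dF :
  (forall i, is_cderive p v (F i) (dF i)) ->
  is_cderive p v (fun q => \sum_(i <- r) F i q) (\sum_(i <- r) dF i).
Proof.
move=> hF; elim: r => [|i r IH].
  rewrite big_nil (_ : (fun _ => _) = fun=> 0); first exact: is_cderive_cst.
  by apply/funext => q; rewrite big_nil.
rewrite big_cons (_ : (fun _ => _) = fun q => F i q + \sum_(j <- r) F j q).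
  exact: is_cderiveD.
by apply/funext => q; rewrite big_cons.
Qed.

Lemma is_mxderiveD m k p v (F G : V -> 'M[R[i]]_(m, k)) dF dG :
  is_mxderive p v F dF -> is_mxderive p v G dG ->
  is_mxderive p v (fun q => F q + G q) (dF + dG).
Proof.
move=> /is_mxderiveP hF /is_mxderiveP hG; apply/is_mxderiveP => i j.
have := is_cderiveD (hF i j) (hG i j).
by rewrite mxE; congr is_cderive; apply/funext => q; rewrite mxE.
Qed.

Lemma is_mxderive_adj m k p v (F : V -> 'M[R[i]]_(m, k)) dF :
  is_mxderive p v F dF -> is_mxderive p v (fun q => adj (F q)) (adj dF).
Proof.
move=> /is_mxderiveP hF; apply/is_mxderiveP => i j.
have := is_cderive_conj (hF j i).
by rewrite !mxE; congr is_cderive; apply/funext => q; rewrite !mxE.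
Qed.

Lemma is_mxderiveM m k l p v (F : V -> 'M[R[i]]_(m, k)) (G : V -> 'M[R[i]]_(k, l)) dF dG :
  is_mxderive p v F dF -> is_mxderive p v G dG ->
  is_mxderive p v (fun q => F q *m G q) (dF *m G p + F p *m dG).
Proof.
move=> /is_mxderiveP hF /is_mxderiveP hG; apply/is_mxderiveP => i j.
have := is_cderive_sum (index_enum 'I_k) (fun s => is_cderiveM (hF i s) (hG s j)).
rewrite big_split /= !mxE; congr is_cderive.
by apply/funext => q; rewrite mxE.
Qed.

Lemma is_mxderiveZ m k p v a da (F : V -> 'M[R[i]]_(m, k)) dF :
  is_cderive p v a da -> is_mxderive p v F dF ->
  is_mxderive p v (fun q => a q *: F q) (da *: F p + a p *: dF).
Proof.
move=> ha /is_mxderiveP hF; apply/is_mxderiveP => i j.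
have := is_cderiveM ha (hF i j); rewrite !mxE; congr is_cderive.
by apply/funext => q; rewrite mxE.
Qed.

Lemma is_mxderive_cst m k p v (A : 'M[R[i]]_(m, k)) : is_mxderive p v (fun=> A) 0.
Proof.
apply/is_mxderiveP => i j; rewrite mxE; exact: is_cderive_cst.
Qed.

End ComplexDerivative.

Section Velocity.
Context {R : realType}.

Lemma velocityE m k (F : R -> 'M[R[i]]_(m, k)) t dF :
  is_mxderive t (1 : R) F dF -> velocity F t = dF.
Proof. by move=> [_ e]; rewrite /velocity derive1E e real_mxK. Qed.

Lemma velocityP m k (F : R -> 'M[R[i]]_(m, k)) t :
  csmooth F -> is_mxderive t (1 : R) F (velocity F t).
Proof.
move=> sF; rewrite /is_mxderive /velocity complex_mxK derive1E.
exact: smooth_is_derive.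
Qed.

Lemma csmooth_velocity m k (F : R -> 'M[R[i]]_(m, k)) :
  csmooth F -> csmooth (velocity F).
Proof.
move=> sF; rewrite /csmooth (_ : (fun _ => _) = 'D_1 (fun t => real_mx (F t))).
  exact: smooth_derive.
by apply/funext => t; rewrite /velocity complex_mxK derive1E.
Qed.

Lemma is_cderive_cis (theta : R) :
  is_cderive theta (1 : R) (@cis R) ('i%C * cis theta).
Proof.
split; rewrite ?ReM ?ImM /= !mul0r !mul1r ?sub0r ?add0r.
  exact: is_derive_cos.
exact: is_derive_sin.
Qed.

End Velocity.

(** * The Hermitian product, normal projections and Hopf surfaces *)

Section HermitianProduct.
Context {R : realType} {m : nat}.
Implicit Types (u v w : 'rV[R[i]]_m) (a : R[i]).

Definition herm u v : R[i] := (u *m adj v) 0 0.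

Lemma mulmx_adj u v : u *m adj v = (herm u v)%:M.
Proof. exact: mx11_scalar. Qed.

Lemma hermDl u v w : herm (u + v) w = herm u w + herm v w.
Proof. by rewrite /herm mulmxDl mxE. Qed.

Lemma hermDr u v w : herm w (u + v) = herm w u + herm w v.
Proof. by rewrite /herm adjD mulmxDr mxE. Qed.

Lemma hermZl a u v : herm (a *: u) v = a * herm u v.
Proof. by rewrite /herm -scalemxAl mxE. Qed.

Lemma hermZr a u v : herm u (a *: v) = conjc a * herm u v.
Proof. by rewrite /herm Defs.adjZ -scalemxAr mxE. Qed.

Lemma hermNl u v : herm (- u) v = - herm u v.
Proof. by rewrite -scaleN1r hermZl mulN1r. Qed.

Lemma herm0l v : herm 0 v = 0.
Proof. by rewrite /herm mul0mx mxE. Qed.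

Lemma herm_conj u v : herm v u = conjc (herm u v).
Proof.
have -> : conjc (herm u v) = (adj (u *m adj v)) 0 0 by rewrite /adj mxE [RHS]mxE.
by rewrite adjM adjK.
Qed.

Lemma dot_herm u v : dot (real_mx u) (real_mx v) = complex.Re (herm u v).
Proof. by rewrite dot_real_mx /mxtrace big_ord1. Qed.

Lemma Im_herm_self u : complex.Im (herm u u) = 0.
Proof.
have := congr1 (@complex.Im R) (herm_conj u u).
by rewrite Im_conjc => /eqP; rewrite -addr_eq0 -mulr2n mulrn_eq0 /= => /eqP.
Qed.

Lemma herm_selfE u : herm u u = (complex.Re (herm u u))%:C%C.
Proof. by apply: complex_eqP => //=; rewrite Im_herm_self. Qed.

Lemma Re_herm_self u :
  complex.Re (herm u u) = \sum_j (complex.Re (u 0 j) ^+ 2 + complex.Im (u 0 j) ^+ 2).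
Proof.
rewrite /herm mxE raddf_sum; apply: eq_bigr => j _.
by rewrite !mxE /= ReM Re_conjc Im_conjc mulrN opprK !expr2.
Qed.

Lemma herm_ge0 u : 0 <= complex.Re (herm u u).
Proof. by rewrite Re_herm_self sumr_ge0 // => j _; rewrite addr_ge0 ?sqr_ge0. Qed.

Lemma herm_gt0 u : u != 0 -> 0 < complex.Re (herm u u).
Proof.
move=> u0; rewrite lt_neqAle herm_ge0 andbT; apply: contra u0 => /eqP e.
apply/eqP/rowP => j; rewrite mxE.
have := esym e; rewrite Re_herm_self => /eqP.
rewrite psumr_eq0 => [/allP/(_ j (mem_index_enum _))|k _]; last first.
  by rewrite addr_ge0 ?sqr_ge0.
rewrite paddr_eq0 ?sqr_ge0 // !sqrf_eq0 => /andP[/eqP r0 /eqP i0].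
exact: complex_eqP.
Qed.

Lemma is_cderive_herm (V : normedModType R) (p v : V) (F G : V -> 'rV[R[i]]_m) dF dG :
  is_mxderive p v F dF -> is_mxderive p v G dG ->
  is_cderive p v (fun q => herm (F q) (G q)) (herm dF (G p) + herm (F p) dG).
Proof.
move=> hF hG.
have := (is_mxderiveP _ _ _ _).1 (is_mxderiveM hF (is_mxderive_adj hG)) 0 0.
by rewrite mxE.
Qed.

Lemma complex_smooth_herm (V : normedModType R) (F G : V -> 'rV[R[i]]_m) :
  csmooth F -> csmooth G -> complex_smooth (fun q => herm (F q) (G q)).
Proof.
move=> sF sG.
exact: ((csmoothP _).1 (csmooth_mulmx sF (csmooth_adj sG)) 0 0).
Qed.

End HermitianProduct.

Section RealMatrix.
Context {R : realType}.

Lemma real_mxD m k (A B : 'M[R[i]]_(m, k)) :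
  real_mx (A + B) = real_mx A + real_mx B.
Proof.
rewrite /real_mx add_row_mx; congr row_mx; apply/matrixP => i j; rewrite !mxE.
  exact: ReD.
exact: ImD.
Qed.

Lemma real_mxZ m k (a : R) (A : 'M[R[i]]_(m, k)) :
  real_mx (a%:C%C *: A) = a *: real_mx A.
Proof.
rewrite /real_mx scale_row_mx; congr row_mx; apply/matrixP => i j; rewrite !mxE.
  by rewrite ReM /= mul0r subr0.
by rewrite ImM /= mul0r addr0.
Qed.

Lemma real_mx0 m k : real_mx (0 : 'M[R[i]]_(m, k)) = 0.
Proof. by have := real_mxZ 0 (0 : 'M[R[i]]_(m, k)); rewrite scaler0 scale0r. Qed.

Lemma real_mx_inj m k : injective (@real_mx R m k).
Proof. exact: can_inj (@real_mxK R m k). Qed.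

End RealMatrix.

Section NormalProjection.
Context {R : realType} {N : nat}.

Lemma dotDl (u v w : 'rV[R]_N) : dot (u + v) w = dot u w + dot v w.
Proof. by rewrite /dot mulmxDl mxtraceD. Qed.

Lemma dotZl a (u w : 'rV[R]_N) : dot (a *: u) w = a * dot u w.
Proof. by rewrite /dot -scalemxAl mxtraceZ. Qed.

Lemma dotC (u w : 'rV[R]_N) : dot u w = dot w u.
Proof. by rewrite /dot -mxtrace_tr trmx_mul trmxK. Qed.

Lemma dot_suml I (r : seq I) (F : I -> 'rV[R]_N) w :
  dot (\sum_(i <- r) F i) w = \sum_(i <- r) dot (F i) w.
Proof. by rewrite /dot mulmx_suml raddf_sum. Qed.

(** The formula for the projection uses the inverse Gram matrix; this
    characterization lets it be evaluated by exhibiting a decomposition. *)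
Lemma normal_proj_decomp (x : R * R -> 'rV[R]_N) p nu (a : R) (b : 'I_2 -> R) :
  sphere (x p) -> (forall i, dot (x p) (partial x i p) = 0) ->
  first_form x p \in unitmx -> normal_vector x p nu ->
  normal_proj x p (nu + a *: x p + \sum_i b i *: partial x i p) = nu.
Proof.
move=> xx xd gu [nx nd]; set z := nu + _ + _.
have zx : dot z (x p) = a.
  rewrite /z !dotDl nx dotZl xx mulr1 add0r dot_suml big1 ?addr0 // => i _.
  by rewrite dotZl dotC xd mulr0.
have zd i : dot z (partial x i p) = ((\row_j b j) *m first_form x p) 0 i.
  rewrite /z !dotDl nd dotZl xd mulr0 !add0r dot_suml mxE.
  by apply: eq_bigr => j _; rewrite dotZl !mxE.
rewrite /normal_proj; have -> : \sum_i \sum_j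
   (first_form_inv x p i j * dot z (partial x i p)) *: partial x j p =
   \sum_i b i *: partial x i p.
  rewrite exchange_big /=; apply: eq_bigr => j _; rewrite -scaler_suml.
  congr (_ *: _).
  transitivity (((\row_j b j) *m first_form x p *m invmx (first_form x p)) 0 j).
    by rewrite [RHS]mxE; apply: eq_bigr => i _; rewrite zd mulrC.
  by rewrite mulmxK // mxE.
by rewrite zx /z addrAC !addrK.
Qed.

End NormalProjection.

Section HopfSurfaces.
Context {R : realType}.

Lemma is_derive_axis0 (W : normedModType R) (f : R * R -> W) t theta d :
  is_derive t (1 : R) (fun y => f (y, theta)) d ->
  is_derive (t, theta) ((1, 0) : R * R) f d.
Proof.
move=> [df de].
have E : (fun h : R => f (h *: (1, 0) + (t, theta))) =
         (fun h => (fun y => f (y, theta)) (h *: 1 + t)).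
  apply/funext => h; congr f.
  by rewrite [LHS](_ : _ = (h * 1 + t, h * 0 + theta))// mulr0 add0r.
apply: DeriveDef.
  by apply: (derivable1P _ _ _).2; rewrite E; exact: ((derivable1P _ _ _).1 df).
by rewrite -de [LHS]derive1_shift [RHS]derive1_shift E.
Qed.

Lemma is_derive_axis1 (W : normedModType R) (f : R * R -> W) t theta d :
  is_derive theta (1 : R) (fun y => f (t, y)) d ->
  is_derive (t, theta) ((0, 1) : R * R) f d.
Proof.
move=> [df de].
have E : (fun h : R => f (h *: (0, 1) + (t, theta))) =
         (fun h => (fun y => f (t, y)) (h *: 1 + theta)).
  apply/funext => h; congr f.
  by rewrite [LHS](_ : _ = (h * 0 + t, h * 1 + theta))// mulr0 add0r.
apply: DeriveDef.
  by apply: (derivable1P _ _ _).2; rewrite E; exact: ((derivable1P _ _ _).1 df).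
by rewrite -de [LHS]derive1_shift [RHS]derive1_shift E.
Qed.

Context {n : nat}.
Implicit Types (F G C : R -> 'rV[R[i]]_n.+1).

Lemma partial_theta F :
  partial (hopf_surface F) 1 = hopf_surface (fun t => 'i%C *: F t).
Proof.
apply/funext => -[t theta]; rewrite /partial /axis /=.
have h : is_mxderive theta (1 : R) (fun y => cis y *: F t)
    (cis theta *: ('i%C *: F t)).
  apply: is_mxderive_eq (is_mxderiveZ (is_cderive_cis theta) (is_mxderive_cst _ _ _)) _.
  by rewrite scaler0 addr0 /= scalerA mulrC.
exact: (@derive_val _ _ _ _ _ _ _ (is_derive_axis1 (f := hopf_surface F) h)).
Qed.

Lemma partial_t F : csmooth F ->
  partial (hopf_surface F) 0 = hopf_surface (velocity F).
Proof.
move=> sF; apply/funext => -[t theta]; rewrite /partial /axis /=.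
have h : is_mxderive t (1 : R) (fun y => cis theta *: F y)
    (cis theta *: velocity F t).
  apply: is_mxderive_eq (is_mxderiveZ (is_cderive_cst _ _ _) (velocityP t sF)) _.
  by rewrite scale0r add0r.
exact: (@derive_val _ _ _ _ _ _ _ (is_derive_axis0 (f := hopf_surface F) h)).
Qed.

Lemma dot_hopf_surface F G p :
  dot (hopf_surface F p) (hopf_surface G p) = complex.Re (herm (F p.1) (G p.1)).
Proof. by rewrite dot_herm hermZl hermZr mulrA cis_conjc mul1r. Qed.

Lemma hopf_surfaceZ (a : R -> R) F p :
  hopf_surface (fun t => (a t)%:C%C *: F t) p = a p.1 *: hopf_surface F p.
Proof. by rewrite /hopf_surface scalerA mulrC -scalerA real_mxZ. Qed.

Lemma hopf_surface_eq0 F p : hopf_surface F p = 0 -> F p.1 = 0.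
Proof.
rewrite /hopf_surface -(real_mx0 (R := R)) => /real_mx_inj e.
by rewrite -[F p.1]scale1r -(cis_conjc p.2) mulrC -scalerA e scaler0.
Qed.

Lemma smooth_fst : smooth (fun p : R * R => p.1).
Proof.
apply: (@smooth_lin _ _ _ (fst : {linear (R * R)%type -> R})) => p.
exact: cvg_fst.
Qed.

Lemma smooth_snd : smooth (fun p : R * R => p.2).
Proof.
apply: (@smooth_lin _ _ _ (snd : {linear (R * R)%type -> R})) => p.
exact: cvg_snd.
Qed.

Lemma csmooth_comp1 (V : normedModType R) m k (F : R -> 'M[R[i]]_(m, k)) (h : V -> R) :
  csmooth F -> smooth h -> csmooth (fun p => F (h p)).
Proof.
move=> /csmoothP sF sh; apply/csmoothP => i j.
by have [s1 s2] := sF i j; split; [exact: (smooth_comp1 s1)|exact: (smooth_comp1 s2)].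
Qed.

Lemma csmooth_comp2 (V : normedModType R) m k (F : R * R -> 'M[R[i]]_(m, k))
    (h1 h2 : V -> R) :
  csmooth F -> smooth h1 -> smooth h2 -> csmooth (fun p => F (h1 p, h2 p)).
Proof.
move=> /csmoothP sF sh1 sh2; apply/csmoothP => i j.
by have [s1 s2] := sF i j; split;
  [exact: (smooth_comp2 s1)|exact: (smooth_comp2 s2)].
Qed.

Lemma smooth_hopf_surface F : csmooth F -> smooth (hopf_surface F).
Proof.
move=> sF; apply: csmoothZ; first exact/complex_smooth_cis/smooth_snd.
exact: csmooth_comp1 smooth_fst.
Qed.

Lemma csphereE (Z : 'rV[R[i]]_n.+1) : csphere Z <-> herm Z Z = 1.
Proof.
rewrite /csphere /= mulmx_adj; split=> [/matrixP/(_ 0 0)|->//].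
by rewrite !mxE.
Qed.

Lemma csphereZ a (Z : 'rV[R[i]]_n.+1) :
  a * conjc a = 1 -> csphere Z -> csphere (a *: Z).
Proof.
by move=> a1 /csphereE hZ; apply/csphereE; rewrite hermZl hermZr hZ mulr1.
Qed.

End HopfSurfaces.

(** * Geometry of the surface swept out by a lift *)

Section TwoByTwo.
Context {R : realType}.

Lemma ord2P (a : 'I_2) : a = 0 \/ a = 1.
Proof. by case: a => -[|[|//]] h; [left|right]; apply: val_inj. Qed.

Lemma big_ord2 (V : nmodType) (F : 'I_2 -> V) : \sum_i F i = F 0 + F 1.
Proof.
rewrite big_ord_recl big_ord1; congr (F _ + F _); exact: val_inj.
Qed.

Lemma det_mx2 (M : 'M[R]_2) : \det M = M 0 0 * M 1 1 - M 0 1 * M 1 0.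
Proof.
rewrite (expand_det_row _ 0) big_ord2 /cofactor !det_mx11 !mxE /=.
rewrite expr0 expr1 mul1r mulN1r mulrN.
by congr (_ * M _ _ - _ * M _ _); apply: val_inj.
Qed.

Lemma mean_curvature_expand N (x : R * R -> 'rV[R]_N) p : mean_curvature x p =
  2^-1 *: (first_form_inv x p 0 0 *: second_form x 0 0 p
         + first_form_inv x p 0 1 *: second_form x 0 1 p
         + (first_form_inv x p 1 0 *: second_form x 1 0 p
         + first_form_inv x p 1 1 *: second_form x 1 1 p)).
Proof.
rewrite /mean_curvature; congr (_ *: _).
rewrite [LHS]big_ord2.
congr (_ + _).
  exact: big_ord2.
exact: big_ord2.
Qed.

End TwoByTwo.

Section HopfSurfaceGeometry.
Context {R : realType} {n : nat}.
Variable C : R -> 'rV[R[i]]_n.+1.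
Hypothesis sC : csmooth C.
Hypothesis CS : forall t, csphere (C t).

Local Notation C1 := (velocity C).
Local Notation x := (hopf_surface C).

(** The speed at which a lift turns along the fibres; the product of [C'] with [C]
    is imaginary because [C] has constant length, and it vanishes for horizontal
    lifts. *)
Definition fibre_rate t : R := complex.Im (herm (C1 t) (C t)).

Definition horizontal_velocity t : 'rV[R[i]]_n.+1 :=
  C1 t - herm (C1 t) (C t) *: C t.

Lemma herm_lift t : herm (C t) (C t) = 1.
Proof. by apply/csphereE. Qed.

Lemma herm_velocity t : herm (C1 t) (C t) = ('i * (fibre_rate t)%:C)%C.
Proof.
apply: complex_eqP; rewrite ?ReM ?ImM /= ?mul0r ?mul1r ?mulr0 ?subr0 ?add0r//.
have := is_cderive_herm (velocityP t sC) (velocityP t sC).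
rewrite (_ : (fun q => herm (C q) (C q)) = fun=> 1); last first.
  by apply/funext => q; rewrite herm_lift.
move=> /is_cderive_cst_eq0 /(congr1 (@complex.Re R)) /=.
rewrite ReD (herm_conj (C1 t) (C t)) Re_conjc => /eqP.
by rewrite -mulr2n mulrn_eq0 /= => /eqP.
Qed.

Lemma horizontal_velocity_perp t : herm (horizontal_velocity t) (C t) = 0.
Proof. by rewrite /horizontal_velocity hermDl hermNl hermZl herm_lift mulr1 subrr. Qed.

Lemma horizontal_velocity_normsq t :
  complex.Re (herm (horizontal_velocity t) (horizontal_velocity t)) =
  complex.Re (herm (C1 t) (C1 t)) - fibre_rate t ^+ 2.
Proof.
rewrite {2}/horizontal_velocity -scaleNr hermDr hermZr horizontal_velocity_perp.
rewrite mulr0 addr0 /horizontal_velocity hermDl hermNl hermZl ReD ReN.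
rewrite [herm (C t) _]herm_conj herm_velocity; congr (_ - _).
by rewrite !(ReM, ImM, Re_conjc, Im_conjc) /=; ring.
Qed.

Lemma sphere_hopf_surface p : sphere (x p).
Proof. by rewrite /sphere /= dot_hopf_surface herm_lift. Qed.

Lemma partial0E : partial x 0 = hopf_surface C1. Proof. exact: partial_t. Qed.

Lemma partial1E : partial x 1 = hopf_surface (fun t => ('i *: C t)%C).
Proof. exact: partial_theta. Qed.

Lemma hopf_surface_perp p i : dot (x p) (partial x i p) = 0.
Proof.
rewrite dotC; case: (ord2P i) => ->.
  rewrite partial0E dot_hopf_surface herm_velocity ReM /=; ring.
by rewrite partial1E dot_hopf_surface hermZl herm_lift ReM /=; ring.
Qed.

Lemma first_form00 p : first_form x p 0 0 = complex.Re (herm (C1 p.1) (C1 p.1)).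
Proof. by rewrite mxE partial0E dot_hopf_surface. Qed.

Lemma first_form01 p : first_form x p 0 1 = fibre_rate p.1.
Proof.
rewrite mxE partial0E partial1E dot_hopf_surface hermZr herm_velocity.
by rewrite !(ReM, ImM, Re_conjc, Im_conjc) /=; ring.
Qed.

Lemma first_form10 p : first_form x p 1 0 = fibre_rate p.1.
Proof. by rewrite -first_form01 [LHS]mxE [RHS]mxE; exact: dotC. Qed.

Lemma first_form11 p : first_form x p 1 1 = 1.
Proof.
rewrite mxE partial1E dot_hopf_surface hermZr hermZl herm_lift.
by rewrite !(ReM, ImM, Re_conjc, Im_conjc) /=; ring.
Qed.


Local Notation V := horizontal_velocity.

Definition horizontal_normsq t := complex.Re (herm (V t) (V t)).
Local Notation v2 := horizontal_normsq.

Lemma det_first_form p : \det (first_form x p) = v2 p.1.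
Proof.
rewrite det_mx2 first_form00 first_form01 first_form10 first_form11 mulr1.
by rewrite /horizontal_normsq horizontal_velocity_normsq expr2.
Qed.

Lemma velocity_decomp t : C1 t = V t + ('i * (fibre_rate t)%:C)%C *: C t.
Proof. by rewrite -herm_velocity /horizontal_velocity subrK. Qed.

Definition hopf_normal : R * R -> 'rV[R]_(n.+1 + n.+1) :=
  hopf_surface (fun t => 'i%C *: V t).

Lemma real_mx_comb4 m k z (b c d : R) (A B D E : 'M[R[i]]_(m, k)) :
  real_mx (z *: (A + b%:C%C *: B + (c%:C%C *: D + d%:C%C *: E))) =
  real_mx (z *: A) + b *: real_mx (z *: B)
  + (c *: real_mx (z *: D) + d *: real_mx (z *: E)).
Proof.
have zC u F : z *: (u%:C%C *: F) = u%:C%C *: (z *: F) by rewrite !scalerA mulrC.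
rewrite scalerDr real_mxD; congr (_ + _); rewrite scalerDr real_mxD zC real_mxZ //.
by congr (_ + _); rewrite zC real_mxZ.
Qed.

Lemma normal_proj_hopf W F p (a b0 b1 : R) :
  0 < v2 p.1 -> herm (W p.1) (C p.1) = 0 ->
  complex.Re (herm (W p.1) (C1 p.1)) = 0 ->
  F p.1 = W p.1 + a%:C%C *: C p.1
          + (b0%:C%C *: C1 p.1 + b1%:C%C *: ('i%C *: C p.1)) ->
  normal_proj x p (hopf_surface F p) = hopf_surface W p.
Proof.
move=> v0 WC WC1 FE; pose b (i : 'I_2) := if i == 0 then b0 else b1.
rewrite -[RHS](@normal_proj_decomp _ _ x p _ a b) //.
- rewrite big_ord2 /b /= partial0E partial1E; congr (normal_proj _ _ _).
  by rewrite /hopf_surface FE real_mx_comb4.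
- exact: sphere_hopf_surface.
- exact: hopf_surface_perp.
- by rewrite unitmxE det_first_form unitfE gt_eqF.
- split=> [|i]; first by rewrite dot_hopf_surface WC.
  case: (ord2P i) => ->; first by rewrite partial0E dot_hopf_surface.
  by rewrite partial1E dot_hopf_surface hermZr WC mulr0.
Qed.

(** The multiples of [i c] are adjusted because the tangent vector [w + i f c]
    has a component along the fibre. *)
Lemma span_decomp (al be : R[i]) (f : R) (c w : 'rV[R[i]]_n.+1) :
  al *: c + be *: w =
  (complex.Im be)%:C%C *: ('i%C *: w) + (complex.Re al)%:C%C *: c
  + ((complex.Re be)%:C%C *: (w + ('i * f%:C)%C *: c)
  + (complex.Im al - f * complex.Re be)%:C%C *: ('i%C *: c)).
Proof.
have e1 : al = (complex.Re al)%:C%C + ((complex.Re be)%:C * ('i * f%:C) +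
     (complex.Im al - f * complex.Re be)%:C * 'i)%C.
  case: al be => [a1 a2] [b1 b2].
  by apply: complex_eqP; rewrite !(ReM, ImM, ReD, ImD) /=; ring.
have e2 : be = ((complex.Im be)%:C * 'i)%C + (complex.Re be)%:C%C.
  case: be {e1} => [b1 b2].
  by apply: complex_eqP; rewrite !(ReM, ImM, ReD, ImD) /=; ring.
rewrite [in LHS]e2 [in LHS]e1 !scalerDr !scalerA !scalerDl [LHS]addrC -!addrA.
by congr (_ + _); exact: addrCA.
Qed.

(** The projection of a vector of the complex span of a lift and of its
    horizontal velocity [V] has only an [iV] component, since [C], [iC] and [V]
    are real combinations of the surface and of its two tangent vectors. *)
Lemma normal_proj_hopf_span F p (al be : R[i]) :
  0 < v2 p.1 -> F p.1 = al *: C p.1 + be *: V p.1 ->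
  normal_proj x p (hopf_surface F p) = complex.Im be *: hopf_normal p.
Proof.
move=> v0 FE.
rewrite -(hopf_surfaceZ (fun=> complex.Im be)).
apply: normal_proj_hopf => //.
- by rewrite !hermZl horizontal_velocity_perp !mulr0.
- rewrite velocity_decomp hermDr !hermZl !hermZr horizontal_velocity_perp.
  by rewrite !mulr0 addr0 herm_selfE !ReM /=; ring.
- rewrite FE velocity_decomp; exact: span_decomp.
Qed.

Lemma hopf_velocityZ t : velocity (fun t => 'i%C *: C t) t = 'i%C *: C1 t.
Proof.
apply: velocityE.
apply: is_mxderive_eq (is_mxderiveZ (is_cderive_cst _ _ _) (velocityP t sC)) _.
by rewrite scale0r add0r.
Qed.

Variables (la mu : R -> R[i]).
Hypothesis v0 : forall t, 0 < v2 t.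
Hypothesis C2E : forall t, velocity C1 t = la t *: C t + mu t *: V t.

Lemma dot_hopf_normal p : dot (hopf_normal p) (hopf_normal p) = v2 p.1.
Proof.
rewrite dot_hopf_surface hermZl hermZr mulrA /horizontal_normsq.
by rewrite (_ : 'i * conjc 'i = 1)%C ?mul1r //; apply: complex_eqP => /=; ring.
Qed.

Lemma second_form00 p :
  second_form x 0 0 p = complex.Im (mu p.1) *: hopf_normal p.
Proof.
rewrite /second_form partial0E partial_t; last exact: csmooth_velocity.
exact: (normal_proj_hopf_span (v0 p.1) (C2E p.1)).
Qed.

Lemma normal_proj_velocity p :
  normal_proj x p (hopf_surface (fun t => 'i%C *: C1 t) p) = hopf_normal p.
Proof.
have e : 'i%C *: C1 p.1 =
    ('i * ('i * (fibre_rate p.1)%:C))%C *: C p.1 + 'i%C *: V p.1.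
  by rewrite velocity_decomp scalerDr scalerA addrC.
have := normal_proj_hopf_span (F := fun t => 'i%C *: C1 t) (v0 p.1) e.
by rewrite scale1r.
Qed.

Lemma second_form01 p : second_form x 0 1 p = hopf_normal p.
Proof. by rewrite /second_form partial0E partial_theta normal_proj_velocity. Qed.

Lemma second_form10 p : second_form x 1 0 p = hopf_normal p.
Proof.
rewrite /second_form partial1E partial_t; last first.
  by apply: csmoothZ => //; exact: complex_smooth_cst.
rewrite (_ : velocity _ = fun t => 'i%C *: C1 t) ?normal_proj_velocity //.
by apply/funext => t; exact: hopf_velocityZ.
Qed.

Lemma second_form11 p : second_form x 1 1 p = 0.
Proof.
rewrite /second_form partial1E partial_theta.
have e : 'i%C *: ('i%C *: C p.1) = ('i * 'i)%C *: C p.1 + 0 *: V p.1.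
  by rewrite scalerA scale0r addr0.
have := normal_proj_hopf_span (F := fun t => 'i%C *: ('i%C *: C t)) (v0 p.1) e.
by rewrite scale0r.
Qed.

Lemma first_form_invE p i j : first_form_inv x p i j = (v2 p.1)^-1 *
  (if i == 0 then if j == 0 then 1 else - fibre_rate p.1
   else if j == 0 then - fibre_rate p.1 else complex.Re (herm (C1 p.1) (C1 p.1))).
Proof.
pose B : 'M[R]_2 := \matrix_(i, j) ((v2 p.1)^-1 *
  (if i == 0 then if j == 0 then 1 else - fibre_rate p.1
   else if j == 0 then - fibre_rate p.1 else complex.Re (herm (C1 p.1) (C1 p.1)))).
have gu : first_form x p \in unitmx.
  by rewrite unitmxE det_first_form unitfE gt_eqF.
have BE k l : B k l = (v2 p.1)^-1 * (if k == 0 then if l == 0 then 1 else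
    - fibre_rate p.1 else if l == 0 then - fibre_rate p.1 else
    complex.Re (herm (C1 p.1) (C1 p.1))) by rewrite mxE.
rewrite -BE; suff BM : B *m first_form x p = 1%:M.
  suff -> : first_form_inv x p = B by [].
  by rewrite /first_form_inv -[LHS]mul1mx -BM mulmxK.
have v2E := det_first_form p.
rewrite det_mx2 first_form00 first_form01 first_form10 first_form11 in v2E.
have vn : v2 p.1 != 0 by rewrite gt_eqF.
clearbody B; apply/matrixP => {}i {}j; rewrite mxE big_ord2. rewrite !BE.
have EE : complex.Re (herm (C1 p.1) (C1 p.1)) = v2 p.1 + fibre_rate p.1 ^+ 2.
  by rewrite -v2E; ring.
case: (ord2P i) => ->; case: (ord2P j) => -> /=;
  rewrite ?first_form00 ?first_form01 ?first_form10 ?first_form11 ?EE;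
  by rewrite [RHS]mxE /=; field.
Qed.

(** In units of [hopf_normal], whose length is [v = sqrt v2], the second
    fundamental form has entries [Im mu], [1] and [0]. In the orthonormal frame
    [((d_t - phi d_theta) / v, d_theta)] its entries have lengths
    [kappa = (Im mu - 2 phi) / v], [1] and [0], so the trace-free part has diagonal
    entries [kappa / 2] and [- kappa / 2] and off-diagonal entries [1]. *)
Lemma hopf_willmore_density p :
  tracefree_normsq x p * area_density x p =
  ((complex.Im (mu p.1) - 2 * fibre_rate p.1) ^+ 2 / v2 p.1 + 4) / 2
  * Num.sqrt (v2 p.1).
Proof.
rewrite /area_density det_first_form; congr (_ * _).
set m := complex.Im _; set f := fibre_rate _; set v := v2 _.
have vn : v != 0 by rewrite gt_eqF ?v0.
(* the mean curvature, in units of the normal *)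
pose H := 2^-1 * (v^-1 * (m - 2 * f)).
have HE : mean_curvature x p = H *: hopf_normal p.
  rewrite mean_curvature_expand.
  rewrite second_form00 second_form01 second_form10 second_form11.
  rewrite 4!first_form_invE.
  rewrite /=.
  rewrite scaler0 addr0 scalerA -!scalerDl scalerA; congr (_ *: _).
  by rewrite /H -/m -/f -/v; ring.
pose tau (a b : 'I_2) : R := (if a == 0 then if b == 0 then m else 1 else
   if b == 0 then 1 else 0) - first_form x p a b * H.
have tE a b : tracefree_form x a b p = tau a b *: hopf_normal p.
  rewrite /tracefree_form HE scalerA /tau scalerBl; congr (_ - _).
  case: (ord2P a) => ->; case: (ord2P b) => -> /=.
  - by rewrite second_form00.
  - by rewrite second_form01 scale1r.
  - by rewrite second_form10 scale1r.
  - by rewrite second_form11 scale0r.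
have dE a b c d : dot (tracefree_form x a b p) (tracefree_form x c d p) =
   tau a b * tau c d * v.
  by rewrite !tE dotZl dotC dotZl dot_hopf_normal mulrA.
rewrite /tracefree_normsq !big_ord2 !dE !first_form_invE /= -/f -/v.
rewrite /tau /= !first_form00 !first_form01 !first_form10 !first_form11 -/f.
have -> : complex.Re (herm (C1 p.1) (C1 p.1)) = v + f ^+ 2.
  by rewrite /v /horizontal_normsq horizontal_velocity_normsq subrK.
by rewrite /H; clearbody m f v; field.
Qed.

End HopfSurfaceGeometry.

(** * Flatness of the normal bundle *)

Lemma Re_real_imaginary (R : realType) (a b : R) :
  complex.Re (a%:C * ('i * b%:C))%C = 0.
Proof. by rewrite !ReM /=; ring. Qed.

Section FlatNormalBundle.
Context {R : realType} {n : nat}.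
Variable c : R -> 'rV[R[i]]_n.+1.
Hypothesis sc : csmooth c.
Hypothesis cS : forall t, csphere (c t).
Hypothesis cH : forall t, herm (velocity c t) (c t) = 0.
Hypothesis c1_neq0 : forall t, velocity c t != 0.

Local Notation c1 := (velocity c).
Local Notation c2 := (velocity c1).
Local Notation x := (hopf_surface c).

Definition speedsq t := complex.Re (herm (c1 t) (c1 t)).
Local Notation E := speedsq.

Lemma speedsq_gt0 t : 0 < E t. Proof. exact: herm_gt0. Qed.

Lemma horizontal_velocity_lift t : horizontal_velocity c t = c1 t.
Proof. by rewrite /horizontal_velocity cH scale0r subr0. Qed.

Lemma horizontal_normsq_lift t : 0 < horizontal_normsq c t.
Proof. by rewrite /horizontal_normsq horizontal_velocity_lift speedsq_gt0. Qed.

Lemma herm_acceleration t : herm (c2 t) (c t) = - (E t)%:C%C.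
Proof.
have := is_cderive_herm (velocityP t (csmooth_velocity sc)) (velocityP t sc).
rewrite (_ : (fun q => herm (c1 q) (c q)) = fun=> 0); last first.
  by apply/funext => q; rewrite cH.
move=> /is_cderive_cst_eq0/eqP; rewrite addr_eq0 => /eqP ->.
by rewrite herm_selfE.
Qed.

Definition acceleration_ratio t : R[i] := herm (c2 t) (c1 t) / (E t)%:C%C.
Local Notation mu := acceleration_ratio.

(** The component of the acceleration orthogonal to the complex plane spanned
    by [c] and its velocity. *)
Definition osculating_defect t := c2 t + (E t)%:C%C *: c t - mu t *: c1 t.
Local Notation u := osculating_defect.

Lemma EC_neq0 t : (E t)%:C%C != 0 :> R[i].
Proof. by rewrite eq_complex /= eqxx andbT gt_eqF ?speedsq_gt0. Qed.

Lemma herm_defect (a2 a1 a0 w : 'rV[R[i]]_n.+1) (e m : R[i]) :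
  herm (a2 + e *: a0 - m *: a1) w = herm a2 w + e * herm a0 w - m * herm a1 w.
Proof. by rewrite !hermDl hermNl !hermZl. Qed.

Lemma osculating_defect_perp t : herm (u t) (c t) = 0.
Proof.
have cc : herm (c t) (c t) = 1 by apply/csphereE.
by rewrite [LHS]herm_defect cH cc herm_acceleration mulr1 mulr0 subr0 addNr.
Qed.

Lemma osculating_defect_perp_velocity t : herm (u t) (c1 t) = 0.
Proof.
have c01 : herm (c t) (c1 t) = 0 by rewrite herm_conj cH conjc0.
have c11 : herm (c1 t) (c1 t) = (E t)%:C%C by exact: herm_selfE.
by rewrite [LHS]herm_defect c01 c11 mulr0 addr0 divfK ?EC_neq0 ?subrr.
Qed.

Lemma acceleration_decomp (a2 a1 a0 : 'rV[R[i]]_n.+1) (e : R) (m : R[i]) :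
  'i%C *: a2 =
  'i%C *: (a2 + e%:C%C *: a0 - m *: a1) + (complex.Re m)%:C%C *: ('i%C *: a1)
  + ((- complex.Im m)%:C%C *: a1 + (- e)%:C%C *: ('i%C *: a0)).
Proof.
apply/rowP => j; rewrite !mxE; move: (a2 0 j) (a1 0 j) (a0 0 j).
case: m => [m1 m2] [x2 y2] [x1 y1] [x0 y0].
by apply: complex_eqP; rewrite !(ReM, ImM, ReD, ImD, ReN, ImN) /=; ring.
Qed.

(** The normal field [i c'] is parallel along the fibres, and its normal
    derivative along [c] is [w = i u + Re mu (i c')]. Differentiating along the
    fibre multiplies [w] by [i], and [i (i c')] is tangent, so that the other
    mixed derivative is [- u]. *)
Lemma flat_osculating : flat_normal_bundle x -> forall t, u t = 0.
Proof.
move=> flat t.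
pose xi := hopf_surface (fun t => 'i%C *: c1 t).
have sxi : smooth xi.
  apply: smooth_hopf_surface; apply: csmoothZ; first exact: complex_smooth_cst.
  exact: csmooth_velocity.
have nxi p : normal_vector x p (xi p).
  split=> [|i]; first by rewrite dot_hopf_surface hermZl cH mulr0.
  case: (ord2P i) => ->; rewrite ?partial0E // ?partial1E dot_hopf_surface.
    by rewrite hermZl herm_selfE ReM /=; ring.
  by rewrite hermZl hermZr cH !mulr0.
have v0 s : 0 < horizontal_normsq c s := horizontal_normsq_lift s.
have D1 : normal_connection x 1 xi = fun=> 0.
  apply/funext => p; rewrite /normal_connection partial_theta.
  rewrite (@normal_proj_hopf _ _ c sc cS (fun=> 0) _ p 0 (-1) 0) //=.
  - by rewrite /hopf_surface scaler0 real_mx0.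
  - by rewrite herm0l.
  - by rewrite herm0l.
  rewrite !scale0r !addr0 !add0r scalerA; congr (_ *: _).
  by apply: complex_eqP; rewrite !(ReM, ImM) /=; ring.
pose w s := 'i%C *: u s + (complex.Re (mu s))%:C%C *: ('i%C *: c1 s).
have D0 : normal_connection x 0 xi = hopf_surface w.
  apply/funext => p; rewrite /normal_connection partial_t; last first.
    apply: csmoothZ; first exact: complex_smooth_cst.
    exact: csmooth_velocity.
  apply: (@normal_proj_hopf _ _ c sc cS w _ p 0 (- complex.Im (mu p.1)) (- E p.1)).
  - by [].
  - by rewrite /w hermDl !hermZl osculating_defect_perp cH !mulr0 addr0.
  - rewrite /w hermDl !hermZl osculating_defect_perp_velocity herm_selfE.
    by rewrite mulr0 add0r; exact: Re_real_imaginary.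
  rewrite hopf_velocityZ; last exact: csmooth_velocity.
  rewrite /w scale0r addr0 /osculating_defect; exact: acceleration_decomp.
have D01 : normal_connection x 0 (normal_connection x 1 xi) = fun=> 0.
  apply/funext => p; rewrite D1 /normal_connection /partial derive_cst.
  have -> : 0 = hopf_surface (fun=> 0 : 'rV[R[i]]_n.+1) p.
    by rewrite /hopf_surface scaler0 real_mx0.
  apply: (@normal_proj_hopf _ _ c sc cS (fun=> 0) (fun=> 0) p 0 0 0);
    rewrite ?herm0l ?scale0r ?addr0 //.
have D10 p : normal_connection x 1 (normal_connection x 0 xi) p =
    hopf_surface (fun t => - u t) p.
  rewrite D0 /normal_connection partial_theta.
  apply: (@normal_proj_hopf _ _ c sc cS _ _ p 0 (- complex.Re (mu p.1)) 0).
  - by [].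
  - by rewrite hermNl osculating_defect_perp oppr0.
  - by rewrite hermNl osculating_defect_perp_velocity oppr0.
  rewrite /w !scale0r !addr0 scalerDr !scalerA; congr (_ + _ *: _).
    by rewrite -scaleN1r; congr (_ *: _); apply: complex_eqP => /=; ring.
  move: (complex.Re (mu p.1)) => r.
  by apply: complex_eqP; rewrite !(ReM, ImM) /=; ring.
have := flat xi sxi nxi (t, 0); rewrite D01 D10 => /esym/hopf_surface_eq0 /eqP.
by rewrite oppr_eq0 => /eqP.
Qed.

End FlatNormalBundle.

(** * The osculating plane *)

Section ConstantPlane.
Context {R : realType}.

Lemma is_derive_inv (V : normedModType R) (p v : V) (f : V -> R) df :
  is_derive p v f df -> f p != 0 ->
  is_derive p v (fun q => (f q)^-1) (- (f p) ^- 2 * df).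
Proof.
move=> [d e] f0; apply: DeriveDef; first exact: derivableV.
by rewrite deriveV // e.
Qed.

Lemma is_cderive_real (V : normedModType R) (p v : V) (f : V -> R) df :
  is_derive p v f df -> is_cderive p v (fun q => (f q)%:C%C) df%:C%C.
Proof. by move=> fd; split=> //=; exact: is_derive_cst. Qed.

Lemma is_mxderive0_cst m k (F : R -> 'M[R[i]]_(m, k)) a b :
  (forall t, is_mxderive t (1 : R) F 0) -> F a = F b.
Proof.
move=> dF; apply/matrixP => i j.
have dFij t := (is_mxderiveP _ _ _ _).1 (dF t) i j.
apply: complex_eqP.
  apply: (@is_derive_0_is_cst _ (fun t => complex.Re (F t i j))) => t.
  by have [] := dFij t; rewrite mxE.
apply: (@is_derive_0_is_cst _ (fun t => complex.Im (F t i j))) => t.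
by have [] := dFij t; rewrite mxE.
Qed.

Lemma rank_orthogonal_pair m (u w : 'rV[R[i]]_m) :
  u != 0 -> w != 0 -> herm u w = 0 -> \rank (col_mx u w) = 2%N.
Proof.
move=> u0 w0 uw; apply/eqP; rewrite -[_ == _]/(row_free (col_mx u w)).
apply: inj_row_free => v; rewrite -[v]hsubmxK mul_row_col.
set a := lsubmx v; set b := rsubmx v.
rewrite (mx11_scalar a) (mx11_scalar b) !mul_scalar_mx => e.
have a0 : a 0 0 = 0.
  have := congr1 (herm^~ u) e; rewrite /= hermDl !hermZl (herm_conj u w) uw.
  rewrite conjc0 mulr0 addr0 herm0l => /eqP; rewrite mulf_eq0 => /orP[/eqP//|].
  by rewrite herm_selfE eq_complex /= gt_eqF ?herm_gt0.
move: e; rewrite a0 scale0r add0r => /eqP; rewrite scaler_eq0 (negPf w0).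
have z : (0 : R[i])%:M = 0 :> 'M[R[i]]_1 by exact: raddf0.
by rewrite orbF => /eqP ->; rewrite z row_mx0.
Qed.

Context {n : nat}.
Variable c : R -> 'rV[R[i]]_n.+1.
Hypothesis sc : csmooth c.
Hypothesis cS : forall t, csphere (c t).
Hypothesis cH : forall t, herm (velocity c t) (c t) = 0.
Hypothesis c1_neq0 : forall t, velocity c t != 0.

Local Notation c1 := (velocity c).
Local Notation c2 := (velocity c1).
Local Notation E := (speedsq c).
Local Notation mu := (acceleration_ratio c).

Lemma projector_derivative (e : R) (m : R[i]) (A B D : 'M[R[i]]_n.+1) : e != 0 ->
  B + A + ((- e ^- 2 * (2 * complex.Re m * e))%:C%C *: D +
    (e^-1)%:C%C *: ((conjc m *: D - e%:C%C *: A) + (m *: D - e%:C%C *: B))) = 0.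
Proof.
move=> e0.
have -> : (conjc m *: D - e%:C%C *: A) + (m *: D - e%:C%C *: B) =
    (2 * complex.Re m)%:C%C *: D - e%:C%C *: (B + A).
  rewrite addrACA -opprD [_ *: A + _]addrC -scalerDr -scalerDl; congr (_ *: D - _).
  by case: m => a b; apply: complex_eqP => /=; ring.
move: (B + A) => S.
rewrite scalerDr scalerN !scalerA [X in S + X]addrA -scalerDl.
have -> : ((- e ^- 2 * (2 * complex.Re m * e))%:C +
    (e^-1)%:C * (2 * complex.Re m)%:C = 0 :> R[i])%C.
  by apply: complex_eqP => /=; field.
have -> : ((e^-1)%:C * e%:C = 1 :> R[i])%C.
  by apply: complex_eqP => /=; field.
by rewrite scale0r add0r scale1r subrr.
Qed.

Lemma Re_herm_addC (v w : 'rV[R[i]]_n.+1) (m : R[i]) (e : R) :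
  herm v w = m * e%:C%C ->
  complex.Re (herm v w + herm w v) = 2 * complex.Re m * e.
Proof.
by move=> h; rewrite (herm_conj v w) h; case: m {h} => m1 m2 /=; ring.
Qed.

(** The complex plane spanned by [c] and its velocity, as a projector. *)
Definition osculating_projector t : 'M[R[i]]_n.+1 :=
  adj (c t) *m c t + ((E t)^-1)%:C%C *: (adj (c1 t) *m c1 t).

(** Without defect, [c'' = mu c' - E c]. The terms of the derivative in [mu] are
    compensated by the change of the length of [c'], and those in [E] by the
    rotation of [c]. *)
Lemma osculating_projector_cst a b : (forall t, osculating_defect c t = 0) ->
  osculating_projector a = osculating_projector b.
Proof.
move=> u0; apply: is_mxderive0_cst => t.
have dc := velocityP t sc.
have dc1 := velocityP t (csmooth_velocity sc).
have E0 : E t != 0 by rewrite gt_eqF ?speedsq_gt0.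
have dE : is_derive t (1 : R) E (2 * complex.Re (mu t) * E t).
  have [+ _] := is_cderive_herm dc1 dc1.
  have h : herm (c2 t) (c1 t) = mu t * (E t)%:C%C by rewrite divfK ?EC_neq0.
  move=> dE; exact: (is_derive_eq dE (Re_herm_addC h)).
have := is_mxderiveD (is_mxderiveM (is_mxderive_adj dc) dc)
  (is_mxderiveZ (is_cderive_real (is_derive_inv dE E0))
     (is_mxderiveM (is_mxderive_adj dc1) dc1)).
rewrite /= => /is_mxderive_eq; apply.
have -> : c2 t = mu t *: c1 t - (E t)%:C%C *: c t.
  apply/eqP; rewrite -subr_eq0 opprB addrA [_ - _]addrAC; apply/eqP.
  by rewrite -[RHS](u0 t) /osculating_defect addrAC.
rewrite adjD !Defs.adjZ -scaleNr Defs.adjZ mulmxDl mulmxDr -!scalemxAl -!scalemxAr.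
rewrite rmorphN /= oppr0 !scaleNr.
exact: projector_derivative.
Qed.

Definition lift_plane : 'M[R[i]]_(2, n.+1) := col_mx (c 0) (c1 0).

Lemma rank_lift_plane : \rank lift_plane = 2%N.
Proof.
apply: rank_orthogonal_pair => //; last by rewrite herm_conj cH conjc0.
by have := cS 0; apply: contraPneq => ->; apply/csphereE; rewrite herm0l => /esym/eqP;
  rewrite oner_eq0.
Qed.

(** The projector at time [t] fixes [c t], and it equals the one at time [0],
    whose image is spanned by [c 0] and its velocity. *)
Lemma lift_in_plane t : (forall t, osculating_defect c t = 0) ->
  (c t <= lift_plane)%MS.
Proof.
move=> u0.
have cP s : c s *m osculating_projector s = c s.
  rewrite mulmxDr -scalemxAr !mulmxA !mulmx_adj !mul_scalar_mx.
  rewrite [herm (c s) (c1 s)]herm_conj cH conjc0 scale0r scaler0 addr0.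
  by have /csphereE -> := cS s; rewrite scale1r.
rewrite -(cP t) (osculating_projector_cst t 0 u0).
rewrite mulmxDr -scalemxAr !mulmxA !mulmx_adj !mul_scalar_mx.
have [s0 s1] : (c 0 <= lift_plane)%MS /\ (c1 0 <= lift_plane)%MS.
  by apply/andP; rewrite -col_mx_sub submx_refl.
by apply: addmx_sub; rewrite ?scalerA scalemx_sub.
Qed.

End ConstantPlane.

(** * Curvature of the projected curve *)

Section TangentProjection.
Context {R : realType} {n : nat}.
Implicit Types (Z w : 'rV[R[i]]_n.+1) (A B : 'M[R[i]]_n.+1).

(** The differential of [hopf] at [Z], as a real linear map. *)
Definition hopf_diff Z w : 'M[R[i]]_n.+1 := adj w *m Z + adj Z *m w.

Lemma hopf_diffZ Z w (a : R) :
  a%:C%C *: hopf_diff Z w = hopf_diff Z (a%:C%C *: w).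
Proof.
by rewrite /hopf_diff Defs.adjZ conjc_real -scalemxAl -scalemxAr -scalerDr.
Qed.

Lemma hopf_diffD Z w1 w2 :
  hopf_diff Z (w1 + w2) = hopf_diff Z w1 + hopf_diff Z w2.
Proof. by rewrite /hopf_diff adjD mulmxDl mulmxDr addrACA. Qed.

Lemma tangent_projD P A B :
  tangent_proj P (A + B) = tangent_proj P A + tangent_proj P B.
Proof.
rewrite /tangent_proj (mulmxDr P) (mulmxDr (1%:M - P)) (mulmxDl (P *m A)).
by rewrite (mulmxDl _ _ P) addrACA.
Qed.

Lemma tangent_projD3 P A B :
  tangent_proj P (A + (B + B)) = tangent_proj P A + (tangent_proj P B + tangent_proj P B).
Proof. by rewrite !tangent_projD. Qed.

Lemma hopf_diffD3 Z w1 w2 :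
  hopf_diff Z w1 + (hopf_diff Z w2 + hopf_diff Z w2) = hopf_diff Z (w1 + (w2 + w2)).
Proof. by rewrite !hopf_diffD. Qed.

Lemma add3_eq A A' B B' : A = A' -> B = B' -> A + (B + B) = A' + (B' + B').
Proof. by move=> -> ->. Qed.

Lemma scaler3 (a b : R[i]) w : (a + (b + b)) *: w = a *: w + (b *: w + b *: w).
Proof. by rewrite !scalerDl. Qed.

Lemma tangent_projZ P a A : tangent_proj P (a *: A) = a *: tangent_proj P A.
Proof.
rewrite /tangent_proj -(scalemxAr a P) -(scalemxAr a (1%:M - P)).
by rewrite -(scalemxAl a (P *m A)) -(scalemxAl a _ P) scalerDr.
Qed.

Variable Z : 'rV[R[i]]_n.+1.
Hypothesis ZS : csphere Z.

(** The second derivative of a projected curve is a sum of such products. *)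
Lemma tangent_proj_outer w1 w2 :
  tangent_proj (hopf Z) (adj w1 *m w2) =
  herm Z w1 *: (adj Z *m (w2 - herm w2 Z *: Z)) +
  herm w2 Z *: (adj (w1 - herm w1 Z *: Z) *m Z).
Proof.
rewrite /tangent_proj /hopf; congr (_ + _).
  rewrite -!mulmxA (mulmxA Z (adj w1)) mulmx_adj mul_scalar_mx -scalemxAr.
  congr (_ *: (_ *m _)); rewrite mulmxBr mulmx1 mulmxA mulmx_adj.
  by rewrite mul_scalar_mx.
rewrite -!mulmxA (mulmxA w2) mulmx_adj mul_scalar_mx -!scalemxAr mulmxA.
congr (_ *: (_ *m _)); rewrite mulmxBl mul1mx adjD -scaleNr Defs.adjZ.
rewrite -!mulmxA mulmx_adj mul_mx_scalar [herm Z w1]herm_conj.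
by rewrite rmorphN /= scaleNr.
Qed.

Lemma tangent_proj_hopf_diff w : herm w Z = 0 ->
  tangent_proj (hopf Z) (hopf_diff Z w) = hopf_diff Z w.
Proof.
move=> wZ; have Zw : herm Z w = 0 by rewrite herm_conj wZ conjc0.
have ZZ : herm Z Z = 1 by apply/csphereE.
rewrite /hopf_diff tangent_projD !tangent_proj_outer Zw wZ ZZ.
by rewrite !scale0r !scale1r !subr0 add0r addr0 addrC.
Qed.

Lemma tangent_proj_base : tangent_proj (hopf Z) (adj Z *m Z) = 0.
Proof.
have ZZ : herm Z Z = 1 by apply/csphereE.
by rewrite tangent_proj_outer ZZ !scale1r subrr adj0 mul0mx mulmx0 addr0.
Qed.

Lemma fs_dot_hopf_diff w : herm w Z = 0 ->
  fs_dot (hopf_diff Z w) (hopf_diff Z w) = complex.Re (herm w w).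
Proof.
move=> wZ; have w0 : w *m adj Z = 0 by rewrite mulmx_adj wZ; exact: raddf0.
by rewrite hopf_submersion // dot_herm.
Qed.

End TangentProjection.

Section CurvatureOfProjection.
Context {R : realType} {n : nat}.
Variable C : R -> 'rV[R[i]]_n.+1.
Hypothesis sC : csmooth C.
Hypothesis CS : forall t, csphere (C t).
Local Notation C1 := (velocity C).
Local Notation V := (horizontal_velocity C).
Local Notation v2 := (horizontal_normsq C).
Local Notation phi := (fibre_rate C).
Local Notation g := (fun t => hopf (C t)).

Lemma velocity_hopf t : velocity g t = hopf_diff (C t) (C1 t).
Proof.
apply: velocityE; exact: (is_mxderiveM (is_mxderive_adj (velocityP t sC)) (velocityP t sC)).
Qed.

Lemma velocity_perp t : herm (V t) (C t) = 0.
Proof. exact: horizontal_velocity_perp. Qed.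

Lemma perp_velocity t : herm (C t) (V t) = 0.
Proof. by rewrite herm_conj velocity_perp conjc0. Qed.

Lemma herm_VV t : herm (V t) (V t) = (v2 t)%:C%C.
Proof. exact: herm_selfE. Qed.

Lemma hopf_diff_vertical Z z : hopf_diff Z (z *: Z) =
  (conjc z + z) *: (adj Z *m Z) :> 'M[R[i]]_n.+1.
Proof. by rewrite /hopf_diff Defs.adjZ -scalemxAl -scalemxAr scalerDl. Qed.

Lemma hopf_diff_velocity t : hopf_diff (C t) (C1 t) = hopf_diff (C t) (V t).
Proof.
rewrite (velocity_decomp sC CS t) hopf_diffD hopf_diff_vertical.
rewrite (_ : conjc _ + _ = 0) ?scale0r ?addr0 //.
by apply: complex_eqP => /=; ring.
Qed.

Lemma speed_hopf t : speed g t = Num.sqrt (v2 t).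
Proof.
rewrite /speed velocity_hopf hopf_diff_velocity fs_dot_hopf_diff //.
exact: velocity_perp.
Qed.

Lemma acceleration_hopf t : velocity (velocity g) t =
  hopf_diff (C t) (velocity C1 t) + (adj (C1 t) *m C1 t + adj (C1 t) *m C1 t).
Proof.
have aux (X Y Z : 'M[R[i]]_n.+1) : X + Y + (Y + Z) = X + Z + (Y + Y).
  by rewrite [Y + Z]addrC addrACA.
have dC := velocityP t sC; have dC1 := velocityP t (csmooth_velocity sC).
rewrite (_ : velocity g = fun t => adj (C1 t) *m C t + adj (C t) *m C1 t); last first.
  by apply/funext => s; rewrite velocity_hopf.
apply: velocityE.
apply: is_mxderive_eq (is_mxderiveD (is_mxderiveM (is_mxderive_adj dC1) dC)
  (is_mxderiveM (is_mxderive_adj dC) dC1)) _.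
exact: aux.
Qed.

Variables (la mu : R -> R[i]).
Hypothesis v0 : forall t, 0 < v2 t.
Hypothesis C2E : forall t, velocity C1 t = la t *: C t + mu t *: V t.

(** The term [- 2 i phi] comes from the product of first derivatives in the second
    derivative of [hopf \o C]; it makes the result independent of the rotation of
    the lift along the fibres. *)
Lemma tangent_proj_acceleration t :
  tangent_proj (g t) (velocity (velocity g) t) =
  hopf_diff (C t) ((mu t - 2 * ('i * (phi t)%:C)%C) *: V t).
Proof.
have e1 : tangent_proj (g t) (hopf_diff (C t) (velocity C1 t)) =
    hopf_diff (C t) (mu t *: V t).
  rewrite C2E hopf_diffD tangent_projD hopf_diff_vertical tangent_projZ.
  rewrite tangent_proj_base // scaler0 add0r tangent_proj_hopf_diff //.
  by rewrite hermZl velocity_perp mulr0.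
have e2 : tangent_proj (g t) (adj (C1 t) *m C1 t) =
    hopf_diff (C t) ((- ('i * (phi t)%:C)%C) *: V t).
  rewrite (tangent_proj_outer (C t)) -[C1 t - _]/(V t) addrC /hopf_diff Defs.adjZ.
  rewrite (herm_conj (C1 t) (C t)) (herm_velocity sC CS t).
  rewrite -scalemxAl -scalemxAr.
  congr (_ *: _ + _ *: _); apply: complex_eqP => /=; ring.
rewrite acceleration_hopf tangent_projD3 (add3_eq e1 e2) hopf_diffD3 -scaler3.
by rewrite (_ : mu t + _ = mu t - 2 * ('i * (phi t)%:C)%C) //; ring.
Qed.

Lemma csmooth_horizontal_velocity : csmooth V.
Proof.
have sC1 := csmooth_velocity sC.
have := csmoothD sC1 (csmoothZ (complex_smooth_cst (-1))
  (csmoothZ (complex_smooth_herm sC1 sC) sC)).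
by congr csmooth; apply/funext => s; rewrite scaleN1r.
Qed.

Lemma herm_velocity_derivative (u w u1 : 'rV[R[i]]_n.+1) (l m a da v : R[i]) :
  herm u w = 0 -> herm w w = v -> herm u1 w = v ->
  herm (l *: u + m *: w + -1 *: (da *: u + a *: u1)) w = (m - a) * v.
Proof.
move=> uw ww u1w.
by rewrite scaleN1r !hermDl hermNl !hermDl !hermZl uw ww u1w; ring.
Qed.

Lemma is_derive_horizontal_normsq t :
  is_derive t (1 : R) v2 (2 * complex.Re (mu t) * v2 t).
Proof.
have dC := velocityP t sC; have dC1 := velocityP t (csmooth_velocity sC).
have dV := is_mxderiveD dC1 (is_mxderiveZ (is_cderive_cst t 1 (-1))
  (is_mxderiveZ (is_cderive_herm dC1 dC) dC)).
have VE : (fun q => C1 q + -1 *: (herm (C1 q) (C q) *: C q)) = V.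
  by apply/funext => s; rewrite scaleN1r.
move: dV; rewrite VE; set dV := (X in is_mxderive _ _ _ X) => hdV.
have [+ _] := is_cderive_herm hdV hdV; rewrite -/v2 => h.
have e : herm dV (V t) = (mu t - ('i * (phi t)%:C)%C) * (v2 t)%:C%C.
  have cv : herm (C1 t) (V t) = (v2 t)%:C%C.
    by rewrite {1}(velocity_decomp sC CS t) hermDl hermZl perp_velocity mulr0 addr0 herm_VV.
  rewrite /dV scale0r add0r C2E (herm_velocity sC CS t).
  exact: (herm_velocity_derivative _ _ _ _ (perp_velocity t) (herm_VV t) cv).
apply: is_derive_eq h _; rewrite (Re_herm_addC e).
by rewrite ReD ReN ReM /=; ring.
Qed.

Lemma velocity_unit_tangent t : velocity (unit_tangent g) t =
  (Num.sqrt (v2 t))^-1%:C%C *: (velocity (velocity g) t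
    + (- complex.Re (mu t))%:C%C *: velocity g t).
Proof.
have sg : csmooth g := csmooth_mulmx (csmooth_adj sC) sC.
have dg := velocityP t (csmooth_velocity sg).
have sq0 : 0 < Num.sqrt (v2 t) by rewrite sqrtr_gt0.
have dsq := is_derive_comp1 (is_derive1_sqrt (v0 t)) (is_derive_horizontal_normsq t).
have ds := is_cderive_real (is_derive_inv dsq (lt0r_neq0 sq0)).
apply: velocityE.
have := is_mxderiveZ ds dg.
rewrite (_ : (fun q => _ *: velocity g q) = unit_tangent g); last first.
  by apply/funext => s; rewrite /unit_tangent speed_hopf.
move/is_mxderive_eq; apply.
rewrite [RHS]scalerDr [RHS]addrC scalerA; congr (_ *: _ + _).
rewrite -rmorphM /=; congr (_%:C)%C.
rewrite -{2}(sqr_sqrtr (ltW (v0 t))); move: (Num.sqrt _) sq0 => s s0.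
by field; rewrite gt_eqF.
Qed.

(** The real part of [mu] only measures the change of speed; normalizing the
    tangent vector removes it. *)
Lemma geodesic_curvature_sq_hopf t : geodesic_curvature_sq g t =
  (complex.Im (mu t) - 2 * phi t) ^+ 2 / v2 t.
Proof.
have sq0 : 0 < Num.sqrt (v2 t) by rewrite sqrtr_gt0.
pose w : 'rV[R[i]]_n.+1 := (((Num.sqrt (v2 t))^-1) ^+ 2)%:C%C *:
  (('i * (complex.Im (mu t) - 2 * phi t)%:C)%C *: V t).
have wC : herm w (C t) = 0 by rewrite !hermZl velocity_perp !mulr0.
have -> : geodesic_curvature_sq g t = fs_dot (hopf_diff (C t) w) (hopf_diff (C t) w).
  rewrite /geodesic_curvature_sq; suff -> : curvature_vector g t = hopf_diff (C t) w by [].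
  rewrite /curvature_vector velocity_unit_tangent tangent_projZ tangent_projD.
  rewrite tangent_projZ tangent_proj_acceleration velocity_hopf hopf_diff_velocity.
  rewrite tangent_proj_hopf_diff ?velocity_perp // hopf_diffZ -hopf_diffD hopf_diffZ.
  rewrite hopf_diffZ speed_hopf; congr (hopf_diff _ _).
  rewrite -scalerDl scalerA -rmorphM /= -expr2; congr (_ *: (_ *: _)).
  by case: (mu t) => m1 m2; apply: complex_eqP => /=; ring.
rewrite fs_dot_hopf_diff // /w !hermZl !hermZr herm_VV.
move: (complex.Im _ - _) => k.
have := esym (sqr_sqrtr (ltW (v0 t))); move: sq0 {w wC}.
move: (Num.sqrt (v2 t)) => s s0 -> /=.
by field; rewrite gt_eqF.
Qed.

Lemma willmore_density_elastic p :
  tracefree_normsq (hopf_surface C) p * area_density (hopf_surface C) p =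
  ((geodesic_curvature_sq g p.1 + 4) * speed g p.1) / 2.
Proof.
rewrite (hopf_willmore_density sC CS v0 C2E) geodesic_curvature_sq_hopf speed_hopf.
by rewrite mulrAC.
Qed.

End CurvatureOfProjection.

(** * Energies of a surface over a plane *)

Lemma velocity_submx (R : realType) m k l (F : R -> 'M[R[i]]_(m, k))
    (L : 'M[R[i]]_(l, k)) t :
  csmooth F -> (forall s, (F s <= L)%MS) -> (velocity F t <= L)%MS.
Proof.
move=> sF FL; rewrite submxE; apply/eqP.
have := is_mxderiveM (velocityP t sF) (is_mxderive_cst t (1 : R) (cokermx L)).
rewrite mulmx0 addr0 => /velocityE <-; apply: velocityE.
rewrite (_ : (fun q => _) = fun=> 0); first exact: is_mxderive_cst.
by apply/funext => s; apply/eqP; rewrite -submxE.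
Qed.

Section SurfaceInPlane.
Context {R : realType} {n : nat}.
Variables (L : 'M[R[i]]_(2, n.+1)) (C : R -> 'rV[R[i]]_n.+1).
Hypothesis sC : csmooth C.
Hypothesis CL : forall t, csphere_in L (C t).
Local Notation g := (fun t => hopf (C t)).
Hypothesis g_regular : forall t, velocity g t != 0.

Local Notation C1 := (velocity C).
Local Notation V := (horizontal_velocity C).
Local Notation v2 := (horizontal_normsq C).
Local Notation phi := (fibre_rate C).

Let CS t : csphere (C t). Proof. by case: (CL t). Qed.

Lemma horizontal_velocity_neq0 t : V t != 0.
Proof.
apply: contra (g_regular t) => /eqP V0; apply/eqP.
rewrite (velocity_hopf sC) (hopf_diff_velocity sC CS) V0.
by rewrite /hopf_diff adj0 mul0mx mulmx0 addr0.
Qed.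

Lemma horizontal_normsq_gt0 t : 0 < v2 t.
Proof. exact/herm_gt0/horizontal_velocity_neq0. Qed.

Lemma lift_neq0 t : C t != 0.
Proof.
apply/eqP => C0; have /csphereE := CS t.
by rewrite C0 herm0l => /esym/eqP; rewrite oner_eq0.
Qed.

(** The lift and its horizontal velocity are orthogonal and nonzero, hence a basis
    of the plane by dimension. *)
Lemma plane_span t (w : 'rV[R[i]]_n.+1) : (w <= L)%MS ->
  w = herm w (C t) *: C t + (herm w (V t) / (v2 t)%:C%C) *: V t.
Proof.
move=> wL.
have CV : herm (C t) (V t) = 0 by exact: perp_velocity.
have VC : herm (V t) (C t) = 0 by exact: velocity_perp.
have CC : herm (C t) (C t) = 1 by apply/csphereE.
have VV : herm (V t) (V t) = (v2 t)%:C%C by exact: herm_VV.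
have v0 : (v2 t)%:C%C != 0 :> R[i].
  by rewrite eq_complex /= eqxx andbT gt_eqF ?horizontal_normsq_gt0.
have rk := rank_orthogonal_pair (lift_neq0 t) (horizontal_velocity_neq0 t) CV.
have VL : (V t <= L)%MS.
  rewrite /horizontal_velocity -scaleNr addmx_sub ?scalemx_sub //.
    by apply: velocity_submx => // s; case: (CL s).
  by case: (CL t).
have sL : (col_mx (C t) (V t) <= L)%MS.
  by rewrite col_mx_sub VL andbT; case: (CL t).
have Ls : (L <= col_mx (C t) (V t))%MS.
  rewrite -(mxrank_leqif_sup sL) rk eqn_leq rank_leq_row andbT.
  by have := mxrankS sL; rewrite rk.
have /submxP[D wE] := submx_trans wL Ls.
move: wE VV v0; rewrite -[D]hsubmxK mul_row_col.
rewrite (mx11_scalar (lsubmx D)) (mx11_scalar (rsubmx D)) !mul_scalar_mx.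
move: (_ 0 0) (_ 0 0) => a b; move: (V t) (C t) CV VC CC => v c cv vc cc -> vv v0.
by rewrite !hermDl !hermZl cv vc cc vv mulr0 addr0 mulr1 mulr0 add0r mulfK.
Qed.

Definition lift_ratio t : R[i] := herm (velocity C1 t) (V t) / (v2 t)%:C%C.

Lemma lift_acceleration t :
  velocity C1 t = herm (velocity C1 t) (C t) *: C t + lift_ratio t *: V t.
Proof.
apply: plane_span; apply: velocity_submx; first exact: csmooth_velocity.
by move=> s; apply: velocity_submx => // r; case: (CL r).
Qed.

Definition elastic_density t := (geodesic_curvature_sq g t + 4) * speed g t.

(** Continuity gives integrability on segments, which allows a constant factor to
    be taken out of the elastic energy. *)
Lemma continuous_elastic_density : continuous elastic_density.
Proof.
have sV := csmooth_horizontal_velocity sC.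
have sC1 := csmooth_velocity sC.
have sv2 : smooth v2 := (complex_smooth_herm sV sV).1.
have sphi : smooth phi := (complex_smooth_herm sC1 sC).2.
have sim := (complex_smooth_herm (csmooth_velocity sC1) sV).2.
have vn t : v2 t != 0 by rewrite gt_eqF // horizontal_normsq_gt0.
have svi := smoothV vn sv2.
have sk := smoothD (smoothM sim svi) (smoothM (smooth_cst _ (-2 : R)) sphi).
have sd := smoothM (smoothD (smoothM (smoothM sk sk) svi) (smooth_cst _ (4 : R)))
  (smooth_sqrt horizontal_normsq_gt0 sv2).
apply: smooth_continuous; move: sd; congr smooth; apply/funext => t.
rewrite /elastic_density (geodesic_curvature_sq_hopf sC CS horizontal_normsq_gt0 lift_acceleration).
rewrite (speed_hopf sC CS) expr2 /lift_ratio.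
have -> (z : R[i]) (r : R) : complex.Im (z / r%:C%C) = complex.Im z * r^-1.
  have [->|r0] := eqVneq r 0; first by rewrite !invr0 !mulr0.
  rewrite -fmorphV /= ImM /=; ring.
by rewrite mulNr.
Qed.

(** The Willmore density does not depend on the angle of the fibre. *)
Lemma willmore_energy_hopf t0 t1 :
  willmore_energy t0 t1 (hopf_surface C) = pi * elastic_energy t0 t1 g.
Proof.
have inner t : \int[lebesgue_measure]_(theta in `[0, 2 * pi])
    (tracefree_normsq (hopf_surface C) (t, theta) *
     area_density (hopf_surface C) (t, theta)) = pi * elastic_density t.
  under eq_Rintegral do rewrite
    (willmore_density_elastic sC CS horizontal_normsq_gt0 lift_acceleration) /=.
  rewrite Rintegral_cst //= lebesgue_measure_itv /= lte_fin.
  rewrite mulr_gt0 ?pi_gt0 //= subr0 -/(elastic_density t).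
  by field.
rewrite /willmore_energy; under eq_Rintegral do rewrite inner.
rewrite RintegralZl //.
apply: continuous_compact_integrable; first exact: segment_compact.
exact/continuous_subspaceT/continuous_elastic_density.
Qed.

End SurfaceInPlane.

(** * Variations *)

(** Positivity along a compact segment of the zero slice persists on
    neighbouring slices. *)
Lemma tube_positive (R : realType) (q : R * R -> R) (t0 t1 : R) :
  continuous q -> (forall t, 0 < q (0, t)) ->
  exists2 e, 0 < e &
    forall s t, `|s| <= e -> t \in `[t0, t1] -> 0 < q (s, t).
Proof.
move=> cq q0.
have K : compact [set` `[t0, t1]] by exact: segment_compact.
have /compact_near_coveringP H := K.
have /nbhs_ballP[e e0 He] : \forall s \near (0 : R),
    [set` `[t0, t1]] `<=` (fun t => 0 < q (s, t)).
  apply: (H R (nbhs (0 : R)) (fun s t => 0 < q (s, t))) => t _.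
  have qst : q (p.2, p.1) @[p --> (t, 0 : R)] --> q (0, t).
    apply: (@continuous_comp _ _ _ (fun p : R * R => (p.2, p.1)) q (t, 0)).
      have c1 : (p : R * R).2 @[p --> (t, 0 : R)] --> (0 : R) by exact: cvg_snd.
      have c2 : (p : R * R).1 @[p --> (t, 0 : R)] --> (t : R) by exact: cvg_fst.
      have c := cvg_pair c1 c2; exact: c.
    exact: cq.
  exact: (cvgr_gt _ qst _ (q0 t)).
exists (e / 2); first by rewrite divr_gt0.
move=> s t se ti; apply: (He s) => //.
rewrite -ball_normE /= sub0r normrN (le_lt_trans se) //.
by rewrite ltr_pdivrMr // ltr_pMr // ltr1n.
Qed.

(** A function with a critical point at [0] after the substitution
    [s = e sin r], which confines the parameter to a bounded interval, has one
    before it. *)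
Lemma is_derive0_sin_reparam (R : realType) (f : R -> R) (e : R) : 0 < e ->
  is_derive (0 : R) (1 : R) (fun r => f (e * sin r)) 0 ->
  is_derive (0 : R) (1 : R) f 0.
Proof.
move=> e0 df.
have a0 : asin (0 / e) = 0 :> R.
  rewrite mul0r -[X in asin X]sin0 sinK //.
  by rewrite in_itv /= oppr_le0 andbb divr_ge0 ?pi_ge0.
have h1 : is_derive (0 : R) (1 : R) (fun s => s / e) (e^-1).
  have h := is_deriveM (is_derive_id (0 : R) (1 : R)) (is_derive_cst e^-1 (0 : R) (1 : R)).
  by apply: is_derive_eq h _; rewrite scaler0 add0r /GRing.scale /= mulr1.
have h2 : is_derive ((0 : R) / e) (1 : R) asin (Num.sqrt (1 - (0 / e) ^+ 2))^-1.
  by apply: is_derive1_asin; rewrite mul0r oppr_lt0 ltr01.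
have h3 := is_derive_comp1 (h := fun s : R => s / e) h2 h1.
have df' : is_derive (asin (0 / e)) (1 : R) (fun r => f (e * sin r)) 0 by rewrite a0.
have := is_derive_comp1 (h := fun s : R => asin (s / e)) df' h3; rewrite mulr0.
apply: near_eq_is_derive.
apply/nbhs_ballP; exists e => // s; rewrite -ball_normE /= sub0r normrN => se.
have s1 : s / e \in `[-1, 1].
  rewrite in_itv /= -ler_norml normrM normfV (gtr0_norm e0).
  by rewrite ler_pdivrMr // mul1r ltW.
by rewrite (asinK s1) mulrC divfK // gt_eqF.
Qed.

Section LiftOfVariation.
Context {R : realType} {n : nat}.
Variables (L : 'M[R[i]]_(2, n.+1)) (c : R -> 'rV[R[i]]_n.+1).
Variable G : R * R -> 'M[R[i]]_n.+1.
Hypothesis sc : csmooth c.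
Hypothesis sG : csmooth G.
Hypothesis GL : forall p, CP1 L (G p).

(** The squared length of the orthogonal projection of [c t] to the line
    represented by the projector [G (s, t)]. *)
Definition overlap (p : R * R) : R := complex.Re (herm (c p.2 *m G p) (c p.2)).

Definition varied_lift (p : R * R) : 'rV[R[i]]_n.+1 :=
  ((Num.sqrt (overlap p))^-1)%:C%C *: (c p.2 *m G p).

(** If [G p] is the projector onto the line of a unit vector [Z], then
    [c G = <c, Z> Z], so that normalizing leaves a unit multiple of [Z]. *)
Lemma varied_liftP p : 0 < overlap p ->
  csphere_in L (varied_lift p) /\ hopf (varied_lift p) = G p.
Proof.
rewrite /varied_lift /overlap; have [Z [ZS ZL] <-] := GL p.
rewrite /hopf mulmxA mulmx_adj mul_scalar_mx hermZl.
rewrite (herm_conj (c p.2) Z); move: (herm _ _) => z.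
set q := complex.Re _ => q0.
have s0 : 0 < Num.sqrt q by rewrite sqrtr_gt0.
set a : R[i] := ((Num.sqrt q)^-1)%:C%C * z.
have a1 : a * conjc a = 1.
  have qs : complex.Re z ^+ 2 + complex.Im z ^+ 2 = Num.sqrt q ^+ 2.
    by rewrite sqr_sqrtr ?ltW // /q ReM Re_conjc Im_conjc mulrN opprK !expr2.
  rewrite /a; move: qs s0; move: (Num.sqrt q) => s; case: (z) => z1 z2 /= qs s0.
  have sn : s != 0 by rewrite gt_eqF.
  apply: complex_eqP => /=; last by ring.
  rewrite !mul0r !subr0 !addr0.
  have -> : s^-1 * z1 * (s^-1 * z1) - s^-1 * z2 * - (s^-1 * z2) =
    (z1 ^+ 2 + z2 ^+ 2) / s ^+ 2 by field.
  by rewrite qs divff // expf_neq0.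
rewrite scalerA -/a; split; first by split; [exact: csphereZ|exact: scalemx_sub].
by rewrite Defs.adjZ -scalemxAl -scalemxAr scalerA mulrC a1 scale1r.
Qed.

Lemma csmooth_varied_lift (V : normedModType R) (h1 h2 : V -> R) :
  smooth h1 -> smooth h2 -> (forall p, 0 < overlap (h1 p, h2 p)) ->
  csmooth (fun p => varied_lift (h1 p, h2 p)).
Proof.
move=> s1 s2 q0.
have sch := csmooth_comp1 sc s2.
have scG := csmooth_mulmx sch (csmooth_comp2 sG s1 s2).
have sq := (complex_smooth_herm scG sch).1.
apply: (csmoothZ (a := fun p => ((Num.sqrt (overlap (h1 p, h2 p)))^-1)%:C%C)) => //.
apply: complex_smooth_real; apply: smoothV.
  by move=> p; rewrite gt_eqF // sqrtr_gt0.
exact: smooth_sqrt.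
Qed.

Lemma continuous_overlap : continuous overlap.
Proof.
have sch := csmooth_comp1 sc (@smooth_snd R).
by have /smooth_continuous := (complex_smooth_herm (csmooth_mulmx sch sG) sch).1.
Qed.

End LiftOfVariation.

Section ImmersedHopfSurface.
Context {R : realType}.

Lemma row_free_jac N (x : R * R -> 'rV[R]_N) p :
  first_form x p \in unitmx -> row_free (jac x p).
Proof.
move=> gu; apply: inj_row_free => v vj.
have jjE : jac x p *m (jac x p)^T = first_form x p.
  apply/matrixP => a b; rewrite !mxE /dot /mxtrace big_ord1 mxE.
  by apply: eq_bigr => k _; rewrite !mxE.
apply: (row_free_inj _ (A := first_form x p)); first by rewrite row_free_unit.
by rewrite -jjE mulmxA vj !mul0mx.
Qed.

Lemma cisD2pi (theta : R) : cis (theta + 2 * pi) = cis theta.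
Proof. by rewrite /cis mulr_natl cosD2pi sinD2pi. Qed.

Lemma immersed_hopf_surface n (L : 'M[R[i]]_(2, n.+1)) (C : R -> 'rV[R[i]]_n.+1) :
  csmooth C -> (forall t, csphere_in L (C t)) ->
  (forall t, velocity (fun s => hopf (C s)) t != 0) ->
  immersed_surface (hopf_surface C).
Proof.
move=> sC CL reg; have CS t : csphere (C t) by case: (CL t).
split=> [|p|t theta|p].
- exact: smooth_hopf_surface.
- exact: sphere_hopf_surface.
- by rewrite /hopf_surface /= cisD2pi.
- apply: row_free_jac; rewrite unitmxE (det_first_form sC CS) unitfE gt_eqF //.
  exact: (horizontal_normsq_gt0 sC CL reg).
Qed.

End ImmersedHopfSurface.

Section WillmoreElastic.
Context {R : realType} {n : nat}.
Variables (L : 'M[R[i]]_(2, n.+1)) (c : R -> 'rV[R[i]]_n.+1).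
Variable g : R -> 'M[R[i]]_n.+1.
Hypothesis sc : csmooth c.
Hypothesis cL : forall t, csphere_in L (c t).
Hypothesis hc : forall t, hopf (c t) = g t.

(** A variation of [g] lifts to the curves obtained by projecting [c] to the
    varied lines and normalizing. Where [g] is not varied this returns [c]
    itself, so the support stays compact. *)
Lemma willmore_elastic :
  regular_curve (CP1 L) g -> willmore (hopf_surface c) -> elastic L g.
Proof.
move=> greg [_ wil]; split; first exact: greg.
move=> t0 t1 G [sG Greg G0 Gout].
have GL p : CP1 L (G p) by case: p => s t; case: (Greg s).
have qg s t : G (s, t) = g t -> overlap c G (s, t) = 1.
  move=> Gg; rewrite /overlap /= Gg -hc /hopf mulmxA.
  have [/csphereE cc _] := cL t.
  by rewrite mulmx_adj cc mul1mx cc.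
have lg s t : G (s, t) = g t -> varied_lift c G (s, t) = c t.
  move=> Gg; rewrite /varied_lift qg // sqrtr1 invr1 scale1r /= Gg -hc /hopf.
  by have [/csphereE cc _] := cL t; rewrite mulmxA mulmx_adj cc mul1mx.
have [e e0 eP] : exists2 e, 0 < e &
    forall s t, `|s| <= e -> t \in `[t0, t1] -> 0 < overlap c G (s, t).
  apply: tube_positive; first exact: continuous_overlap.
  by move=> t; rewrite qg ?G0 ?ltr01.
pose rho (s : R) := e * sin s.
have rho_le s : `|rho s| <= e.
  rewrite normrM (gtr0_norm e0) ger_pMr // ler_norml sin_geN1; exact: sin_le1.
have q0 s t : 0 < overlap c G (rho s, t).
  have [ti|ti] := boolP (t \in `[t0, t1]); first exact: eP.
  by rewrite qg ?ltr01 //; exact: Gout.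
have srho (V : normedModType R) (h : V -> R) : smooth h -> smooth (fun p => rho (h p)).
  by move=> sh; apply: smoothM; [exact: smooth_cst|exact: (smooth_trig sh).2].
pose C s t := varied_lift c G (rho s, t).
have CP s t : csphere_in L (C s t) /\ hopf (C s t) = G (rho s, t).
  exact: varied_liftP.
have CG s : (fun t => hopf (C s t)) = (fun t => G (rho s, t)).
  by apply/funext => t; case: (CP s t).
have sC s : csmooth (C s).
  apply: (@csmooth_varied_lift _ _ c G sc sG R (fun=> rho s) id) => //.
    exact: smooth_cst.
  apply: (@smooth_lin _ _ _ idfun) => t; exact: cvg_id.
have CL s t : csphere_in L (C s t) by case: (CP s t).
have Creg s t : velocity (fun t => hopf (C s t)) t != 0.
  by rewrite CG; case: (Greg (rho s)).
pose X (p : R * (R * R)) := hopf_surface (C p.1) p.2.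
have XV : surface_variation (hopf_surface c) t0 t1 X.
  split=> [|s|p|s t theta ti].
  - have s1 : smooth (fun p : R * (R * R) => p.1).
      apply: (@smooth_lin _ _ _ (fst : {linear (R * (R * R))%type -> R})) => p.
      exact: cvg_fst.
    have s2 : smooth (fun p : R * (R * R) => p.2.1).
      apply: (@smooth_lin _ _ _ (fst \o snd : {linear (R * (R * R))%type -> R})) => p.
      by apply: continuous_comp; [exact: cvg_snd|exact: cvg_fst].
    have s3 : smooth (fun p : R * (R * R) => p.2.2).
      apply: (@smooth_lin _ _ _ (snd \o snd : {linear (R * (R * R))%type -> R})) => p.
      by apply: continuous_comp; [exact: cvg_snd|exact: cvg_snd].
    have sl := csmooth_varied_lift sc sG (srho _ _ s1) s2 (fun p => q0 p.1 p.2.1).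
    exact: (csmoothZ (complex_smooth_cis s3) sl).
  - exact: immersed_hopf_surface (sC s) (CL s) (Creg s).
  - rewrite /X /= /hopf_surface; congr (real_mx (_ *: _)).
    by apply: lg; rewrite /rho sin0 mulr0 G0.
  - rewrite /X /= /hopf_surface /=; congr (real_mx (_ *: _)).
    by apply: lg; exact: Gout.
have dX := wil t0 t1 X XV.
suff dE : is_derive (0 : R) (1 : R)
    (fun s => elastic_energy t0 t1 (fun t => G (rho s, t))) 0.
  exact: (@is_derive0_sin_reparam _
    (fun s => elastic_energy t0 t1 (fun t => G (s, t))) e e0 dE).
have WE : (fun s => willmore_energy t0 t1 (fun p => X (s, p))) =
    (fun s => pi * elastic_energy t0 t1 (fun t => G (rho s, t))).
  apply/funext => s; rewrite -CG.
  exact: (willmore_energy_hopf (sC s) (CL s) (Creg s)).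
rewrite WE in dX.
have h := is_deriveM (is_derive_cst pi^-1 (0 : R) (1 : R)) dX.
have EE : (fun=> pi^-1) * (fun s => pi * elastic_energy t0 t1 (fun t => G (rho s, t))) =
    (fun s => elastic_energy t0 t1 (fun t => G (rho s, t))).
  by apply/funext => s; rewrite [LHS]mulrA mulVf ?mul1r // gt_eqF ?pi_gt0.
by move: h; rewrite EE !scaler0 addr0.
Qed.

End WillmoreElastic.

(** * Real spans and the conclusion *)

Section RealSpan.
Context {R : realType}.

(** The complex row space of [L], as a real row space of twice the rank. *)
Definition real_span {k m} (L : 'M[R[i]]_(k, m)) : 'M[R]_(k + k, m + m) :=
  col_mx (real_mx L) (real_mx ('i%C *: L)).

Lemma real_mxM k m l (A : 'M[R[i]]_(l, k)) (L : 'M[R[i]]_(k, m)) :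
  real_mx (A *m L) = real_mx A *m real_span L.
Proof.
rewrite /real_mx /real_span mul_row_col !mul_mx_row add_row_mx.
congr row_mx; apply/matrixP => i j; rewrite !mxE -big_split.
  rewrite (raddf_sum (@complex.Re R : {additive R[i] -> R})).
  apply: eq_bigr => s _; rewrite !mxE !ReM /= [LHS]ReM; ring.
rewrite (raddf_sum (@complex.Im R : {additive R[i] -> R})).
apply: eq_bigr => s _; rewrite !mxE !ImM /= [LHS]ImM; ring.
Qed.

Lemma row_free_real_span k m (L : 'M[R[i]]_(k, m)) :
  row_free L -> row_free (real_span L).
Proof.
move=> fL; apply: inj_row_free => v.
rewrite -[v]complex_mxK -real_mxM -(real_mx0 (R := R)) => /real_mx_inj e.
have -> : complex_mx v = 0 by apply: (row_free_inj fL); rewrite mul0mx.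
exact: real_mx0.
Qed.

Lemma real_mx_submx k m l (A : 'M[R[i]]_(l, m)) (L : 'M[R[i]]_(k, m)) :
  (A <= L)%MS -> (real_mx A <= real_span L)%MS.
Proof. by move=> /submxP[D ->]; rewrite real_mxM submxMl. Qed.

End RealSpan.

Lemma conformal_id (R : realType) N : conformal_transformation (@id 'rV[R]_N).
Proof.
split.
- by split=> [p|p q _ _|p Sp] //=; exists p.
- exists setT; split=> //; first exact: openT.
  by apply: (@smooth_lin _ _ _ idfun) => p; exact: cvg_id.
- by exists (fun=> 1) => p _; split=> // v w _ _; rewrite !derive_id mul1r.
Qed.

Unset Implicit Arguments.

Theorem proposition5p1 (R : realType) (n : nat) (n_ge1 : (1 <= n)%N)
    (g : R -> 'M[R[i]]_n.+1) (c : R -> 'rV[R[i]]_n.+1)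
    (g_regular : regular_curve CPn g) (c_lift : horizontal_lift g c)
    (x_flat : flat_normal_bundle (hopf_surface c)) :
  (exists (Phi : 'rV[R]_(n.+1 + n.+1) -> 'rV[R]_(n.+1 + n.+1))
          (W : 'M[R]_(4, n.+1 + n.+1)),
      [/\ conformal_transformation Phi,
          \rank W = 4%N
        & forall p, (Phi (hopf_surface c p) <= W)%MS]) /\
  (exists L : 'M[R[i]]_(2, n.+1),
      [/\ \rank L = 2%N,
          forall t, CP1 L (g t)
        & willmore (hopf_surface c) ->
          elastic L g /\
          range (hopf_surface c) =
            real_mx @` (csphere_in L `&` hopf @^-1` range g)]).
Proof.
have [sg _ vg] := g_regular; have [sc cS hc hH] := c_lift.
have gE : g = fun t => hopf (c t) by apply/funext => t; rewrite hc.
have cH t : herm (velocity c t) (c t) = 0.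
  have := hH t; rewrite dot_herm hermZr (herm_velocity sc cS).
  move: (fibre_rate c t) => f h; apply: complex_eqP; move: h => /=; lra.
have c1_neq0 t : velocity c t != 0.
  apply: contra (vg t) => /eqP c10; rewrite gE (velocity_hopf sc) c10.
  by rewrite /hopf_diff adj0 mul0mx mulmx0 addr0.
have u0 := flat_osculating sc cS cH c1_neq0 x_flat.
pose L := lift_plane c.
have cL t : (c t <= L)%MS := lift_in_plane sc cS cH c1_neq0 t u0.
have rL : \rank L = 2%N := rank_lift_plane cS cH c1_neq0.
have csL t : csphere_in L (c t) by split; [exact: cS|exact: cL].
split.
  (* the surface already lies in the 3-sphere of the plane *)
  exists id, (real_span L); split; first exact: conformal_id.
    have rf : row_free (real_span L) by apply: row_free_real_span; apply/eqP.
    exact: (eqP rf).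
  move=> p; have := real_mx_submx (scalemx_sub (cis p.2) (cL p.1)); exact.
exists L; split=> // [t|wil]; first by exists (c t) => //; exact: hc.
split.
  apply: (willmore_elastic sc csL hc _ wil); split=> // t.
  by exists (c t) => //; exact: hc.
apply/seteqP; split=> [_ [[t theta] _ <-]|_ [Z [[ZS ZL] [t _ gt]] <-]].
  exists (cis theta *: c t) => //; split.
    split; last exact: scalemx_sub.
    by apply: csphereZ => //; exact: cis_conjc.
  exists t => //; rewrite -hc; apply/hopf_fibre => //; last by exists theta.
  by apply: csphereZ => //; exact: cis_conjc.
have [theta ->] := (hopf_fibre (cS t) ZS).1 (etrans (hc t) gt).
by exists (t, theta).
Qed.
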